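(* Let $\mathcal{A}$ be a commutative unital $C^*$-algebra with countable spectrum, let $\mathcal{H}$ be a complex separable Hilbert space, and let $\phi\in UCP_{\mathcal{H}}(\mathcal{A})$. Then $\phi$ is a $C^*$-extreme point of $UCP_{\mathcal{H}}(\mathcal{A})$ if and only if $\phi$ is a $*$-homomorphism.
   Context: The spectrum of a commutative unital $C^*$-algebra $\mathcal{A}$ is the compact Hausdorff space $X$ (unique up to homeomorphism) with $\mathcal{A}\cong C(X)$. $\mathcal{B}(\mathcal{H})$ denotes the bounded operators on $\mathcal{H}$, and $UCP_{\mathcal{H}}(\mathcal{A})$ is the set of all unital completely positive linear maps $\mathcal{A}\to\mathcal{B}(\mathcal{H})$. A map $\phi\in UCP_{\mathcal{H}}(\mathcal{A})$ is a $C^*$-extreme point of $UCP_{\mathcal{H}}(\mathcal{A})$ if, whenever $\phi=\sum_{i=1}^n T_i^*\phi_i(\cdot)T_i$ with $\phi_i\in UCP_{\mathcal{H}}(\mathcal{A})$ and invertible $T_i\in\mathcal{B}(\mathcal{H})$ satisfying $\sum_{i=1}^n T_i^*T_i=I_{\mathcal{H}}$, then for every $i$ there is a unitary $U_i\in\mathcal{B}(\mathcal{H})$ with $\phi=U_i^*\phi_i(\cdot)U_i$. *)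

(* Defs.v *)
From HB Require Import structures.
From mathcomp Require Import all_boot all_order all_algebra sesquilinear complex.
From mathcomp Require Import all_classical all_reals all_analysis.

Set Implicit Arguments.
Unset Strict Implicit.
Unset Printing Implicit Defensive.

Import Order.TTheory GRing.Theory Num.Theory.
Import numFieldNormedType.Exports.

Local Open Scope classical_set_scope.
Local Open Scope complex_scope.
Local Open Scope ring_scope.

(* The ring operations are fields of the mixin, and are turned into a canonical
   [comPzRingType] below, because Hierarchy-Builder accepts no structure joining
   rings and normed modules that numeric domains do not inherit from. Nothing
   forces [1 != 0], so the zero algebra is allowed. *)
HB.mixin Record isComCStarAlgebra (R : realType) A
    of CompleteNormedModule R[i] A := {
  cstar_one : A ;
  cstar_mul : A -> A -> A ;
  star : A -> A ;
  cstar_mulA : associative cstar_mul ;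
  cstar_mulC : commutative cstar_mul ;
  cstar_mul1l : left_id cstar_one cstar_mul ;
  cstar_mulDl : left_distributive cstar_mul +%R ;
  cstar_scaleAl : forall (k : R[i]) (a b : A),
    k *: cstar_mul a b = cstar_mul (k *: a) b ;
  starK : involutive star ;
  starD : {morph star : a b / a + b} ;
  starZ : forall (k : R[i]) (a : A), star (k *: a) = Num.conj k *: star a ;
  starM : forall a b : A, star (cstar_mul a b) = cstar_mul (star b) (star a) ;
  cstar_normM : forall a b : A, `|cstar_mul a b| <= `|a| * `|b| ;
  cstar_norm_star : forall a : A, `|cstar_mul (star a) a| = `|a| ^+ 2
}.

#[short(type="comCStarAlgType")]
HB.structure Definition ComCStarAlgebra (R : realType) :=
  { A of isComCStarAlgebra R A & CompleteNormedModule R[i] A }.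

HB.instance Definition _ (R : realType) (A : comCStarAlgType R) :=
  GRing.Zmodule_isComPzRing.Build (ComCStarAlgebra.sort A)
    cstar_mulA cstar_mulC cstar_mul1l cstar_mulDl.

(* [inner] is linear in its first argument, conjugate-linear in the second. *)
HB.mixin Record isHilbert (R : realType) H of CompleteNormedModule R[i] H := {
  inner : {dot H for (@Num.conj R[i])} ;
  inner_norm : forall x : H, `|x| ^+ 2 = inner x x
}.

#[short(type="hilbertType")]
HB.structure Definition Hilbert (R : realType) :=
  { H of isHilbert R H & CompleteNormedModule R[i] H }.

Definition separable_space (T : topologicalType) :=
  exists2 D : set T, countable D & dense D.

Section BoundedOperators.
Context {R : realType} (H : hilbertType R).
Implicit Types f g : H -> H.

Definition bounded_op_pred : {pred H -> H} :=
  fun f => `[< linear f /\ exists M : R[i], forall x, `|f x| <= M * `|x| >].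

Record bounded_op := BoundedOp {
  bounded_op_fun :> H -> H ;
  bounded_opP : bounded_op_fun \in bounded_op_pred }.

HB.instance Definition _ := [isSub for bounded_op_fun].
HB.instance Definition _ := [Choice of bounded_op by <:].

Fact bounded_op_submod : submod_closed bounded_op_pred.
Proof.
split.
  apply/asboolP; split=> [k x y|]; first by rewrite scaler0 addr0.
  by exists 0 => x; rewrite normr0 mul0r.
move=> k f g /asboolP[fL [M fM]] /asboolP[gL [N gN]].
have E z : (k *: f + g) z = k *: f z + g z by [].
apply/asboolP; split=> [l x y|].
  rewrite !E fL gL !scalerDr !scalerA [k * l]mulrC !addrA.
  by congr (_ + _); rewrite addrAC.
exists (`|k| * M + N) => x; rewrite (le_trans (ler_normD _ _))//.
by rewrite mulrDl lerD// normrZ -mulrA ler_wpM2l.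
Qed.

HB.instance Definition _ :=
  GRing.isSubmodClosed.Build R[i] (H -> H) bounded_op_pred bounded_op_submod.
HB.instance Definition _ := [SubChoice_isSubLmodule of bounded_op by <:].

Fact bounded_op_id_subproof : (id : H -> H) \in bounded_op_pred.
Proof. by apply/asboolP; split=> //; exists 1 => x; rewrite mul1r. Qed.
Definition bounded_op_id := BoundedOp bounded_op_id_subproof.

Fact bounded_op_comp_subproof (S T : bounded_op) :
  (S \o T : H -> H) \in bounded_op_pred.
Proof.
have /asboolP[SL [M SM]] := bounded_opP S.
have /asboolP[TL [N TN]] := bounded_opP T.
apply/asboolP; split=> [k x y|] /=; first by rewrite TL SL.
exists (`|M| * N) => x; rewrite (le_trans (SM _))// -mulrA.
have -> : M * `|T x| = `|M| * `|T x|.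
  by rewrite -[in RHS](normr_id (T x)) -normrM ger0_norm// (le_trans _ (SM _)).
by rewrite ler_wpM2l.
Qed.
Definition bounded_op_comp S T := BoundedOp (bounded_op_comp_subproof S T).

Fact bounded_op_eqP (S T : bounded_op) : S =1 T -> S = T.
Proof. by move=> ST; apply/val_inj/funext. Qed.

Fact bounded_op_compA : associative bounded_op_comp.
Proof. by move=> S T U; exact: bounded_op_eqP. Qed.
Fact bounded_op_comp1l : left_id bounded_op_id bounded_op_comp.
Proof. by move=> S; exact: bounded_op_eqP. Qed.
Fact bounded_op_comp1r : right_id bounded_op_id bounded_op_comp.
Proof. by move=> S; exact: bounded_op_eqP. Qed.
Fact bounded_op_compDl : left_distributive bounded_op_comp +%R.
Proof. by move=> S T U; exact: bounded_op_eqP. Qed.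
Fact bounded_op_compDr : right_distributive bounded_op_comp +%R.
Proof.
move=> S T U; apply: bounded_op_eqP => x /=.
have /asboolP[SL _] := bounded_opP S.
by have := SL 1 (T x) (U x); rewrite !scale1r.
Qed.

HB.instance Definition _ := GRing.Zmodule_isPzRing.Build bounded_op
  bounded_op_compA bounded_op_comp1l bounded_op_comp1r
  bounded_op_compDl bounded_op_compDr.
End BoundedOperators.

Notation "''B(' H )" := (bounded_op H) (format "''B(' H )") : type_scope.

Section OperatorNotions.
Context {R : realType} {H : hilbertType R}.
Implicit Types S T U : 'B(H).

(* The adjoint exists by the Riesz representation theorem and is unique, so the
   default value of [xget] is never taken. *)
Definition adjoint T : 'B(H) :=
  xget 0 [set S : 'B(H) | forall x y, inner (T x) y = inner x (S y)].

Definition invertible_op T := exists S, S * T = 1 /\ T * S = 1.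

Definition unitary_op U := adjoint U * U = 1 /\ U * adjoint U = 1.
End OperatorNotions.

Section UCP.
Context {R : realType} {A : comCStarAlgType R} {H : hilbertType R}.
Implicit Types phi : A -> 'B(H).

Definition mxstar n (a : 'M[A]_n) : 'M[A]_n := (map_mx star a)^T.

Definition positive_mx n (a : 'M[A]_n) :=
  exists b : 'M[A]_n, a = mxstar b *m b.

(* Positivity of [T i j] as an operator on the n-fold direct sum of H. *)
Definition positive_opmx n (T : 'M['B(H)]_n) := forall x : 'I_n -> H,
  0 <= \sum_(i < n) inner (\sum_(j < n) T i j (x j)) (x i).

Definition completely_positive phi :=
  forall n (a : 'M[A]_n), positive_mx a -> positive_opmx (map_mx phi a).

Definition ucp phi := [/\ linear phi, phi 1 = 1 & completely_positive phi].

Definition cstar_extreme phi := ucp phi /\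
  forall n (phi_ : 'I_n -> A -> 'B(H)) (T : 'I_n -> 'B(H)),
    (forall i, ucp (phi_ i)) ->
    (forall i, invertible_op (T i)) ->
    \sum_(i < n) adjoint (T i) * T i = 1 ->
    (forall a, phi a = \sum_(i < n) adjoint (T i) * phi_ i a * T i) ->
  forall i, exists2 U, unitary_op U &
    forall a, phi a = adjoint U * phi_ i a * U.

Definition star_homomorphism phi :=
  [/\ linear phi, {morph phi : a b / a * b} &
      forall a, phi (star a) = adjoint (phi a)].
End UCP.

(* X is the spectrum of A: A is *-isomorphic to the algebra C(X) with its
   pointwise operations. *)
Definition is_spectrum (R : realType) (A : comCStarAlgType R)
    (X : topologicalType) :=
  [/\ compact [set: X], hausdorff_space X &
    exists G : A -> X -> R[i]^o,
      [/\ [/\ linear G, injective G &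
            range G = [set f : X -> R[i]^o | continuous f]],
          forall x, G 1 x = 1,
          forall a b x, G (a * b) x = G a x * G b x &
          forall a x, G (star a) x = Num.conj (G a x : R[i])]].

(* Main.v *)
Require Import Defs.
From HB Require Import structures.
From mathcomp Require Import all_boot all_order all_algebra sesquilinear complex.
From mathcomp Require Import all_classical all_reals all_analysis.
From mathcomp Require Import ring lra.

(** A completely positive unital map [phi] on [C(X)] is integration against a
    positive operator valued measure, and [phi] is a homomorphism exactly when
    that measure is projection valued. Both implications are proved by elementary
    Hilbert space arguments, with real parts of inner products ([rip]) and squared
    norms ([nsq]) in place of complex quantities.

    Homomorphisms are extreme ([homomorphism_extreme]). Suppose that
    [phi = sum_i T_i^* phi_i T_i]. The Kadison-Schwarz inequality for the [phi_i]
    bounds [sum_i |phi_i(a) T_i x - T_i phi(a) x| ^ 2] by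
    [<phi(a^* a) x, x> - |phi(a) x| ^ 2], which vanishes for a homomorphism. So
    every [T_i] intertwines [phi] and [phi_i], its absolute value commutes with
    [phi], and the unitary factor in its polar decomposition carries [phi_i] to
    [phi]. This rests on the Riesz representation theorem ([riesz]), which
    provides adjoints, and on square roots of positive invertible operators
    ([pos_sqrt]).

    Extreme maps are homomorphisms ([extreme_homomorphism]). Since [X] is
    countable, Urysohn functions give a sequence [p_n] in [C(X)] decreasing to the
    indicator function of a given point [x], and the strong limit [E] of
    [phi(p_n)] is the atom of the measure at [x]. The heart of the proof is that
    [E] is idempotent ([atom_idempotent]). Extremality says that
    [phi = S^* psi S] with [S] invertible for every completely positive [psi]
    dominated by [phi] such that [psi(1)] and [1 - psi(1)] are invertible
    ([extreme_dominated]). Take for [psi] one half of [phi] with its atom at [x]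
    lowered by a rank one operator [P]. Then the pair [(E - P, 1 - P)] is
    congruent to [(E, 1)], so that every [l] for which [E - P - l (1 - E)] has a
    kernel is one for which [E - l (1 - E)] has a kernel; equivalently,
    [l / (1 + l)] is an eigenvalue of [E]. By separability [E] has only countably
    many eigenvalues. But if [E] is not idempotent, a suitable [P] creates a
    kernel for every small [l > 0] ([rankone_perturbation]), a contradiction.

    Once all the atoms are projections, [phi] is evaluation at [x] on the range
    of the atom at [x] ([atom_eigen]), so [phi(ab) - phi(a) phi(b)] vanishes on
    all these ranges. They span a dense subspace because a vector annihilated by
    every atom is zero; this is a countable covering argument on the compact
    space [X] ([null_vector]). *)

Set Implicit Arguments.
Unset Strict Implicit.
Unset Printing Implicit Defensive.

Import Order.TTheory GRing.Theory Num.Theory.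
Import numFieldNormedType.Exports.

Local Open Scope classical_set_scope.
Local Open Scope complex_scope.
Local Open Scope ring_scope.

(** * The underlying real inner product *)

Section RealInner.
Context {R : realType} {H : hilbertType R}.
Implicit Types (x y z : H) (c : R[i]) (k : R).

Definition rip x y : R := complex.Re (inner x y).
Definition nsq x : R := rip x x.

Lemma innerC x y : inner x y = Num.conj (inner y x).
Proof.
have := @hermC _ _ _ _ (inner : {dot H for @Num.conj R[i]}) x y.
by rewrite expr0 mul1r.
Qed.

Lemma ripC x y : rip x y = rip y x.
Proof. by rewrite /rip innerC; case: (inner y x). Qed.

Lemma innerDl x y z : inner (x + y) z = inner x z + inner y z.
Proof. exact: linearDl. Qed.

Lemma innerZl c x y : inner (c *: x) y = c * inner x y.
Proof. exact: linearZl_LR. Qed.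

Lemma innerZr c x y : inner x (c *: y) = c^* * inner x y.
Proof. exact: linearZr_LR. Qed.

Lemma inner0l x : inner 0 x = 0. Proof. exact: linear0l. Qed.

Lemma ripDl x y z : rip (x + y) z = rip x z + rip y z.
Proof. by rewrite /rip innerDl; move: (inner x z) (inner y z) => [? ?] []. Qed.

Lemma ripDr x y z : rip x (y + z) = rip x y + rip x z.
Proof. by rewrite ripC ripDl !(ripC x). Qed.

Lemma rip0l x : rip 0 x = 0.
Proof. by rewrite /rip inner0l. Qed.

Lemma rip0r x : rip x 0 = 0. Proof. by rewrite ripC rip0l. Qed.

Lemma ripNl x y : rip (- x) y = - rip x y.
Proof. by apply: (addrI (rip x y)); rewrite -ripDl !subrr rip0l. Qed.

Lemma ripNr x y : rip x (- y) = - rip x y.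
Proof. by rewrite ripC ripNl ripC. Qed.

Lemma ripZl k x y : rip (k%:C *: x) y = k * rip x y.
Proof. by rewrite /rip innerZl; case: (inner x y) => a b /=; rewrite mul0r subr0. Qed.

Lemma ripZr k x y : rip x (k%:C *: y) = k * rip x y.
Proof. by rewrite ripC ripZl ripC. Qed.

Definition ripE := (ripDl, ripDr, ripNl, ripNr, ripZl, ripZr, rip0l, rip0r).

Lemma ripZ_conj c x y : rip (c *: x) y = rip x (c^* *: y).
Proof.
rewrite /rip innerZl innerZr; congr (complex.Re (_ * _)).
by case: c => a b; rewrite /Num.conj /= opprK.
Qed.

(** So [rip] determines [inner]. *)
Lemma Im_inner x y : complex.Im (inner x y) = - rip ('i%C *: x) y.
Proof. by rewrite /rip innerZl; case: (inner x y) => a b; simpc. Qed.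

Lemma innerxx x : inner x x = (nsq x)%:C.
Proof.
have : 0 <= inner x x by rewrite dnorm_ge0.
by rewrite /nsq /rip; case: (inner x x) => a b /=; rewrite lecE /= => /andP[/eqP->].
Qed.

Lemma norm_sqE x : `|x| ^+ 2 = (nsq x)%:C.
Proof. by rewrite inner_norm innerxx. Qed.

Lemma nsq_ge0 x : 0 <= nsq x.
Proof. by rewrite -ler0c -innerxx dnorm_ge0. Qed.

Lemma nsq_eq0 x : nsq x = 0 -> x = 0.
Proof.
by move=> x0; apply/eqP; rewrite -(dnorm_eq0 (inner : {dot H for _})) innerxx x0.
Qed.

Lemma nsq_gt0 x : x != 0 -> 0 < nsq x.
Proof.
move=> x0; rewrite lt_neqAle nsq_ge0 andbT eq_sym.
by apply: contra_neq x0; exact: nsq_eq0.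
Qed.

Lemma nsq0 : nsq 0 = 0. Proof. exact: rip0l. Qed.
Lemma nsqN x : nsq (- x) = nsq x. Proof. by rewrite /nsq !ripE opprK. Qed.
Lemma nsqD x y : nsq (x + y) = nsq x + 2 * rip x y + nsq y.
Proof. by rewrite /nsq !ripE (ripC y x); ring. Qed.
Lemma nsqB x y : nsq (x - y) = nsq x - 2 * rip x y + nsq y.
Proof. by rewrite nsqD nsqN !ripE; ring. Qed.
Lemma nsqZ c x : nsq (c *: x) = (complex.Re c ^+ 2 + complex.Im c ^+ 2) * nsq x.
Proof.
rewrite /nsq ripZ_conj scalerA -ripZr; congr (rip x (_ *: x)).
by case: c => a b /=; simpc; congr (_ +i* _); ring.
Qed.
Lemma nsqZr k x : nsq (k%:C *: x) = k ^+ 2 * nsq x.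
Proof. by rewrite nsqZ /= expr0n addr0. Qed.

Lemma nsqD_le x y : nsq (x + y) <= 2 * nsq x + 2 * nsq y.
Proof. by have := nsq_ge0 (x - y); rewrite nsqB nsqD; lra. Qed.

Lemma rip_ext x y : (forall z, rip x z = rip y z) -> x = y.
Proof.
move=> xy; apply/subr0_eq/nsq_eq0.
by rewrite /nsq ripDl ripNl xy subrr.
Qed.

Lemma inner_rip_ext x y x' y' : (forall c, rip (c *: x) y = rip (c *: x') y') ->
  inner x y = inner x' y'.
Proof.
move=> xy; have := xy 'i%C; have := xy 1; rewrite !scale1r => re im.
have := Im_inner x y; have := Im_inner x' y'; rewrite im => <-.
move: re; rewrite /rip; case: (inner x y) (inner x' y') => [a b] [c d] /= -> -> //.
Qed.

(** The discriminant argument, for any form that is nonnegative along the line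
    spanned by two vectors. *)
Lemma discriminant (a b c : R) : 0 <= a ->
  (forall k, 0 <= a * k ^+ 2 + 2 * b * k + c) -> b ^+ 2 <= a * c.
Proof.
rewrite le_eqVlt => /predU1P[<- | a0] q.
  have c0 : 0 <= c by have := q 0; lra.
  have [->|b0] := eqVneq b 0; first by lra.
  have := q (- (c + 1) / (2 * b)); set t := _ / _.
  have tb : t * (2 * b) = - (c + 1) by rewrite /t divfK// mulf_neq0.
  by lra.
have := q (- b / a); set t := _ / _.
have ta : t * a = - b by rewrite /t divfK ?gt_eqF.
have := a0; nra.
Qed.

Lemma rip_CS x y : rip x y ^+ 2 <= nsq x * nsq y.
Proof.
apply: discriminant; first exact: nsq_ge0.
by move=> k; have := nsq_ge0 (k%:C *: x + y); rewrite nsqD nsqZr !ripE; lra.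
Qed.
End RealInner.

(** * Strong limits of vectors and operators *)

Section StrongLimits.
Context {R : realType} {H : hilbertType R}.
Implicit Types (x y z : H) (c : R[i]) (u v : nat -> H) (k e : R) (T S : 'B(H)).

(** Norm convergence, expressed by a real sequence. *)
Definition slim u x := nsq (u n - x) @[n --> \oo] --> (0 : R).

Lemma normr_lt_nsq x (e : R[i]) : 0 < e -> nsq x < complex.Re e ^+ 2 -> `|x| < e.
Proof.
move=> e0 xe.
have eE : e = (complex.Re e)%:C.
  by move: e0; rewrite ltcE; case: (e) => a b /= /andP[/eqP->].
have Re0 : 0 < complex.Re e by rewrite -ltcR -eE.
by rewrite -(ltr_pXn2r (n := 2))// ?nnegrE ?(ltW e0)// norm_sqE eE -rmorphXn ltcR.
Qed.

(** Completeness. Comparing with the [N]-th term alone is enough for a Cauchy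
    sequence, and is what the minimizing sequences below provide. *)
Lemma cauchy_slim u :
  (forall e, 0 < e -> exists N, forall n, (N <= n)%N -> nsq (u n - u N) < e) ->
  exists x, slim u x.
Proof.
move=> uC.
have uc : cvg (u @ \oo).
  apply: cauchy_cvg; apply: cauchy_exP => e e0.
  have [|N uN] := uC (complex.Re e ^+ 2).
    by rewrite exprn_gt0//; move: e0; rewrite ltcE => /andP[].
  exists (u N); change (\forall n \near \oo, ball (u N) e (u n)).
  near=> n; rewrite -ball_normE /ball_ /= -normrN opprB.
  apply: normr_lt_nsq => //; apply: uN; near: n; exact: nbhs_infty_ge.
exists (lim (u @ \oo)); apply/cvgr0Pnorm_lt => e e0.
have s0 : 0 < (Num.sqrt e)%:C by rewrite ltcR sqrtr_gt0.
move/cvgrPdist_lt : uc => /(_ _ s0); apply: filterS => n.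
rewrite ger0_norm ?nsq_ge0// -(ltr_pXn2r (n := 2))// ?nnegrE ?(ltW s0)//.
by rewrite norm_sqE -rmorphXn ltcR sqr_sqrtr ?(ltW e0)// -nsqN opprB.
Unshelve. all: by end_near. Qed.

Lemma cvgMcst k (w : nat -> R) (l : R) :
  w n @[n --> \oo] --> l -> k * w n @[n --> \oo] --> k * l.
Proof. by move=> wl; apply: cvgM => //; exact: cvg_cst. Qed.

Lemma cvg_ext (v w : nat -> R) (l : R) : v =1 w ->
  v n @[n --> \oo] --> l -> w n @[n --> \oo] --> l.
Proof. by move=> /funext->. Qed.

Lemma slim_cst x : slim (fun=> x) x.
Proof. by rewrite /slim subrr nsq0; exact: cvg_cst. Qed.

Lemma slimD u v x y : slim u x -> slim v y -> slim (fun n => u n + v n) (x + y).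
Proof.
move=> ux vy.
apply: (@squeeze_cvgr _ _ _ _ (fun=> 0)
  (fun n => 2 * nsq (u n - x) + 2 * nsq (v n - y))).
- by near=> n; rewrite nsq_ge0/= opprD addrACA nsqD_le.
- exact: cvg_cst.
- rewrite [X in _ --> X](_ : 0 = 2 * 0 + 2 * 0); last by lra.
  exact: (cvgD (cvgMcst ux) (cvgMcst vy)).
Unshelve. all: by end_near. Qed.

Lemma slimZ c u x : slim u x -> slim (fun n => c *: u n) (c *: x).
Proof.
move=> /(@cvgMcst (complex.Re c ^+ 2 + complex.Im c ^+ 2)); rewrite mulr0.
by apply: cvg_ext => n; rewrite -scalerBr nsqZ.
Qed.

Lemma rip_slim0 u v x : slim u 0 -> slim v x ->
  rip (u n) (v n) @[n --> \oo] --> (0 : R).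
Proof.
move=> u0 vx.
have lim0 : rip (u n) (v n) ^+ 2 @[n --> \oo] --> (0 : R).
  apply: (@squeeze_cvgr _ _ _ _ (fun=> 0)
    (fun n => nsq (u n - 0) * (2 * nsq (v n - x) + 2 * nsq x))).
  - near=> n; rewrite sqr_ge0/= subr0 (le_trans (rip_CS _ _))// ler_wpM2l ?nsq_ge0//.
    by rewrite -[X in nsq X <= _](subrK x) nsqD_le.
  - exact: cvg_cst.
  - rewrite -[X in _ --> X](mul0r (2 * 0 + 2 * nsq x)).
    exact: (cvgM u0 (cvgD (cvgMcst vx) (cvg_cst (2 * nsq x)))).
apply/cvgr0Pnorm_lt => e e0.
have e20 : 0 < e ^+ 2 by rewrite exprn_gt0.
move/cvgr0Pnorm_lt : lim0 => /(_ _ e20); apply: filterS => n.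
by rewrite normrX ltr_pXn2r ?nnegrE ?(ltW e0).
Unshelve. all: by end_near. Qed.

Lemma slim_rip u v x y : slim u x -> slim v y ->
  rip (u n) (v n) @[n --> \oo] --> rip x y.
Proof.
move=> ux vy.
have slimB w z : slim w z -> slim (fun n => w n - z) 0.
  by move=> wz; have := slimD wz (slim_cst (- z)); rewrite subrr.
have uxv := rip_slim0 (slimB _ _ ux) vy.
have xvy := rip_slim0 (slimB _ _ vy) (slim_cst x).
rewrite -[rip x y]add0r -[in X in _ --> X](addr0 0).
apply: (@cvg_ext (fun n => rip (u n - x) (v n) + rip (v n - y) x + rip x y)).
  by move=> n; rewrite !ripE !(ripC x); ring.
exact: (cvgD (cvgD uxv xvy) (@cvg_cst _ (rip x y) nat \oo _)).
Qed.

Lemma slim_ripl u x z : slim u x -> rip (u n) z @[n --> \oo] --> rip x z.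
Proof. by move=> ux; exact: (slim_rip ux (slim_cst z)). Qed.

Lemma slim_nsq u x : slim u x -> nsq (u n) @[n --> \oo] --> nsq x.
Proof. by move=> ux; exact: (slim_rip ux ux). Qed.

Lemma slim_unique u x y : slim u x -> slim u y -> x = y.
Proof.
move=> ux uy; apply: rip_ext => z.
by apply: (@cvg_unique _ (@Rhausdorff R) (rip (u n) z @[n --> \oo]));
  exact: slim_ripl.
Qed.

Lemma op_linear T : linear T.
Proof. by have /asboolP[] := bounded_opP T. Qed.

HB.instance Definition _ T :=
  GRing.isLinear.Build R[i] H H *:%R (bounded_op_fun T) (op_linear T).

Lemma opD T x y : T (x + y) = T x + T y. Proof. exact: linearD. Qed.
Lemma opB T x y : T (x - y) = T x - T y. Proof. exact: linearB. Qed.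
Lemma opN T x : T (- x) = - T x. Proof. exact: linearN. Qed.
Lemma op0 T : T 0 = 0. Proof. exact: linear0. Qed.
Lemma opZ T c x : T (c *: x) = c *: T x. Proof. exact: linearZ. Qed.
Lemma op_sum T I (r : seq I) (P : pred I) (F : I -> H) :
  T (\sum_(i <- r | P i) F i) = \sum_(i <- r | P i) T (F i).
Proof. exact: linear_sum. Qed.

Lemma op_bounded T : exists2 M, 0 < M & forall x, nsq (T x) <= M * nsq x.
Proof.
have /asboolP[_ [M TM]] := bounded_opP T.
exists (complex.Re (`|M| ^+ 2) + 1) => [|x].
  by rewrite -add_Re2_Im2 /=; have := sqr_ge0 (complex.Re M);
    have := sqr_ge0 (complex.Im M); lra.
have : `|T x| ^+ 2 <= (`|M| * `|x|) ^+ 2.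
  have TMx := TM x; have M0 : 0 <= M * `|x| := le_trans (normr_ge0 _) TMx.
  rewrite lerXn2r ?nnegrE ?mulr_ge0// (le_trans TMx)//.
  by rewrite -(ger0_norm M0) normrM normr_id.
rewrite exprMn !norm_sqE -add_Re2_Im2 -rmorphM lecR /= => /le_trans; apply.
by rewrite ler_wpM2r ?nsq_ge0// lerDl.
Qed.

Lemma bounded_op_real (f : H -> H) M : linear f ->
  (forall x, nsq (f x) <= M ^+ 2 * nsq x) -> f \in @bounded_op_pred R H.
Proof.
move=> fL fM; apply/asboolP; split=> //.
exists `|M|%:C => x.
rewrite -(ler_pXn2r (n := 2)) ?nnegrE ?mulr_ge0 ?ler0c//.
by rewrite exprMn !norm_sqE -rmorphXn -rmorphM lecR real_normK ?num_real.
Qed.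

Lemma slim_op T u x : slim u x -> slim (T \o u) (T x).
Proof.
move=> ux; have [M _ TM] := op_bounded T.
apply: (@squeeze_cvgr _ _ _ _ (fun=> 0) (fun n => M * nsq (u n - x))).
- by near=> n; rewrite nsq_ge0/= -linearB TM.
- exact: cvg_cst.
- by rewrite -[X in _ --> X](mulr0 M); exact: cvgMcst.
Unshelve. all: by end_near. Qed.

(** A uniform bound is inherited by a strong limit of operators, so the limit is
    again a bounded operator. *)
Lemma op_slim (T_ : nat -> 'B(H)) M :
  (forall n x, nsq (T_ n x) <= M ^+ 2 * nsq x) ->
  (forall x, exists y, slim (T_ ^~ x) y) ->
  exists T : 'B(H), forall x, slim (T_ ^~ x) (T x).
Proof.
move=> TM /choice[f Tf].
have fL : linear f.
  move=> c x y; apply: slim_unique (Tf _) _.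
  under eq_fun do rewrite linearP.
  exact: slimD (slimZ c (Tf x)) (Tf y).
have fM x : nsq (f x) <= M ^+ 2 * nsq x.
  apply: cvgr_to_le (slim_nsq (Tf x)) _; apply: nearW => n; exact: TM.
by exists (BoundedOp (bounded_op_real fL fM)).
Qed.
End StrongLimits.

(** * Riesz representation and adjoints *)

Section Adjoint.
Context {R : realType} {H : hilbertType R}.
Implicit Types (x y z : H) (k : R) (T S : 'B(H)).

(** Riesz representation over the reals. The functional [nsq y - 2 * f y] is
    bounded below, and the parallelogram law makes its minimizing sequences
    Cauchy; its minimizer represents [f]. *)
Lemma riesz (f : H -> R) M : 0 <= M ->
  (forall k x y, f (k%:C *: x + y) = k * f x + f y) ->
  (forall x, f x ^+ 2 <= M * nsq x) -> exists z, forall x, f x = rip x z.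
Proof.
move=> M0 fL fM; pose J y := nsq y - 2 * f y; pose d := inf (range J).
have JD k x y :
    J (y + k%:C *: x) = J y + (nsq x * k ^+ 2 + 2 * (rip y x - f x) * k).
  by rewrite /J (addrC y) fL nsqD nsqZr !ripE (ripC x); ring.
have Jlb : lbound (range J) (- M).
  move=> _ [y _ <-]; rewrite /J leNgt; apply/negP => Jy.
  by have := fM y; have := nsq_ge0 y; have := sqr_ge0 (nsq y - M); nra.
have dJ y : d <= J y by apply: ge_inf; [exists (- M) | exists y].
have /choice[u uJ] n : exists y, J y < d + harmonic n.
  have [||_ [y _ <-] yd] := @inf_adherent _ (range J) (harmonic n).
  - by rewrite /= invr_gt0.
  - by split; [exists (J 0), 0 | exists (- M)].
  - by exists y.
(* [d <= J] at the midpoint of [u n] and [u m] bounds their distance. *)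
have parallelogram m n : nsq (u n - u m) <= 2 * harmonic n + 2 * harmonic m.
  have := dJ ((2^-1)%:C *: (u n + u m)); have := uJ n; have := uJ m.
  rewrite /J nsqZr -[_ *: _]addr0 fL.
  have := fL 1 (u n) (u m); rewrite scale1r => ->.
  have := fL 1 0 0; rewrite scale1r addr0 nsqB nsqD.
  by lra.
have [|z uz] := @cauchy_slim _ _ u.
  move=> e e0.
  have [N _ hN] : \forall n \near \oo, harmonic n < e / 4 :> R.
    by apply: cvgr_lt (@cvg_harmonic R) _ _; rewrite divr_gt0.
  exists N => n Nn; apply: (le_lt_trans (parallelogram N n)).
  have hNN : harmonic N < e / 4 := hN N (leqnn N).
  have hNn : harmonic n < e / 4 := hN n Nn.
  by lra.
exists z => x; rewrite ripC.
(* [J] stays above its infimum along the line through [u n] in direction [x]. *)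
have lim0 : (rip (u n) x - f x) ^+ 2 @[n --> \oo] --> (0 : R).
  apply: (@squeeze_cvgr _ _ _ _ (fun=> 0) (fun n => nsq x * harmonic n)).
  - apply: nearW => n; rewrite sqr_ge0/=.
    apply: (@discriminant _ _ _ (harmonic n) (nsq_ge0 x)) => k.
    have := dJ (u n + k%:C *: x); rewrite JD; have := uJ n.
    by move: (harmonic n) (J (u n)) => e Jn; lra.
  - exact: cvg_cst.
  - by rewrite -[X in _ --> X](mulr0 (nsq x)); apply: cvgMcst cvg_harmonic.
have lim1 : (rip (u n) x - f x) ^+ 2 @[n --> \oo] --> (rip z x - f x) ^+ 2.
  have h : rip (u n) x - f x @[n --> \oo] --> rip z x - f x.
    exact: (cvgB (@slim_ripl _ _ _ _ x uz) (@cvg_cst _ (f x) nat \oo _)).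
  exact: (cvgM h h).
have /eqP : (rip z x - f x) ^+ 2 = 0.
  by apply: (@cvg_unique _ (@Rhausdorff R) ((rip (u n) x - f x) ^+ 2 @[n --> \oo])).
by rewrite sqrf_eq0 subr_eq0 => /eqP.
Qed.

Lemma adjoint_exists T : exists S, forall x y, rip (T x) y = rip x (S y).
Proof.
have [M M0 TM] := op_bounded T.
have /choice[S TS] y : exists z, forall x, rip (T x) y = rip x z.
  apply: (@riesz (fun x => rip (T x) y) (M * nsq y)) => [|k x x'|x].
    by rewrite mulr_ge0 ?nsq_ge0 ?ltW.
    by rewrite linearP !ripE.
  by rewrite (le_trans (rip_CS _ _))// mulrAC ler_wpM2r ?nsq_ge0.
have SL : linear S.
  move=> c y z; apply: rip_ext => x.
  rewrite ripDl ripZ_conj !(ripC (S _)) -!TS ripDr; congr (_ + _).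
  by rewrite linearZ ripC ripZ_conj ripC.
have SM y : nsq (S y) <= Num.sqrt M ^+ 2 * nsq y.
  rewrite sqr_sqrtr; last exact: ltW.
  have [->|Sy0] := eqVneq (S y) 0.
    by rewrite nsq0; exact: mulr_ge0 (ltW M0) (nsq_ge0 y).
  rewrite -(ler_pM2l (nsq_gt0 Sy0)) -expr2 {1}/nsq -TS (le_trans (rip_CS _ _))//.
  by rewrite mulrCA mulrA ler_wpM2r ?nsq_ge0.
by exists (BoundedOp (bounded_op_real SL SM)) => x y; rewrite TS.
Qed.

Lemma rip_inner_adj T S : (forall x y, rip (T x) y = rip x (S y)) ->
  forall x y, inner (T x) y = inner x (S y).
Proof. by move=> TS x y; apply: inner_rip_ext => c; rewrite -TS linearZ. Qed.

Lemma rip_adj T x y : rip (T x) y = rip x (adjoint T y).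
Proof.
have [S /rip_inner_adj TS] := adjoint_exists T.
rewrite /rip; congr complex.Re; move: x y.
exact: (@xgetPex _ 0 [set S : 'B(H) | forall x y, inner (T x) y = inner x (S y)]
  (ex_intro _ S TS)).
Qed.

Lemma adjoint_unique T S : (forall x y, rip (T x) y = rip x (S y)) ->
  adjoint T = S.
Proof.
move=> TS; apply: bounded_op_eqP => y; apply: rip_ext => x.
by rewrite ripC -rip_adj TS ripC.
Qed.

Lemma rip_adjr T x y : rip x (T y) = rip (adjoint T x) y.
Proof. by rewrite ripC rip_adj ripC. Qed.

Lemma adjointK T : adjoint (adjoint T) = T.
Proof. by apply: adjoint_unique => x y; rewrite -rip_adjr. Qed.

Lemma adjoint1 : adjoint (1 : 'B(H)) = 1.
Proof. exact: adjoint_unique. Qed.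

Lemma adjointM T S : adjoint (T * S) = adjoint S * adjoint T.
Proof. by apply: adjoint_unique => x y /=; rewrite !rip_adj. Qed.

End Adjoint.

(** * Square roots of positive operators *)

Section SquareRoot.
Context {R : realType} {H : hilbertType R}.
Implicit Types (x y z : H) (k : R) (T S : 'B(H)).

Lemma op_addE T S x : (T + S) x = T x + S x. Proof. by []. Qed.
Lemma op_oppE T x : (- T) x = - T x. Proof. by []. Qed.
Lemma op_scaleE (c : R[i]) T x : (c *: T) x = c *: T x. Proof. by []. Qed.
Lemma op_mulE T S x : (T * S) x = T (S x). Proof. by []. Qed.
Lemma op_oneE x : (1 : 'B(H)) x = x. Proof. by []. Qed.
Lemma op_zeroE x : (0 : 'B(H)) x = 0. Proof. by []. Qed.
Definition opE := (op_addE, op_oppE, op_scaleE, op_mulE, op_oneE, op_zeroE).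

Lemma op_eqx T S x : T = S -> T x = S x. Proof. by move->. Qed.

Definition selfadj T := forall x y, rip (T x) y = rip x (T y).
Definition pos T := forall x, 0 <= rip (T x) x.

Lemma selfadj_adjoint T : selfadj T -> adjoint T = T.
Proof. exact: adjoint_unique. Qed.

Lemma selfadjZ k T : selfadj T -> selfadj (k%:C *: T).
Proof. by move=> Ts x y; rewrite !opE !ripE Ts. Qed.

Lemma pos_CS T x y : selfadj T -> pos T ->
  rip (T x) y ^+ 2 <= rip (T x) x * rip (T y) y.
Proof.
move=> Ts Tp; apply: discriminant => // k.
have := Tp (k%:C *: x + y); rewrite opD opZ !ripE (Ts y x) (ripC y).
by lra.
Qed.

(** Cauchy-Schwarz for the form of [T], at [x] and [T x]: this is
    [T ^ 2 <= q T] whenever [0 <= T <= q]. *)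
Lemma pos_nsq_le T q : selfadj T -> pos T ->
  (forall x, rip (T x) x <= q * nsq x) ->
  forall x, nsq (T x) <= q * rip (T x) x.
Proof.
move=> Ts Tp Tq x.
have [->|Tx0] := eqVneq (T x) 0; first by rewrite nsq0 rip0l mulr0.
rewrite -(ler_pM2l (nsq_gt0 Tx0)) -expr2 {1}/nsq.
rewrite (le_trans (pos_CS _ _ Ts Tp))// mulrC mulrCA mulrA ler_wpM2r//.
Qed.

(** The map [Y |-> (K + Y ^ 2) / 2] contracts the ball of radius [q], and its
    iterates from 0 are polynomials in [K]; their strong limit [Y] satisfies
    [1 - K = (1 - Y) ^ 2]. *)
Lemma quadratic_fixpoint K q : 0 <= q < 1 -> selfadj K -> pos K ->
  (forall x, rip (K x) x <= q * nsq x) ->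
  exists Y, [/\ selfadj Y, forall x, K x + Y (Y x) = 2%:C *: Y x &
    forall D, D * K = K * D -> D * Y = Y * D].
Proof.
move=> /andP[q0 q1] Ks Kp Kq.
have q21 : q ^+ 2 <= 1 by rewrite expr_le1// ltW.
have Kb x : nsq (K x) <= q ^+ 2 * nsq x.
  by rewrite (le_trans (pos_nsq_le Ks Kp Kq _))// expr2 -mulrA ler_wpM2l.
pose Y_ := fix Y_ n := if n is n'.+1 then (2^-1)%:C *: (K + Y_ n' * Y_ n')
                       else 0 : 'B(H).
have YS n x : Y_ n.+1 x = (2^-1)%:C *: (K x + Y_ n (Y_ n x)) by [].
have Yb n x : nsq (Y_ n x) <= q ^+ 2 * nsq x.
  elim: n x => [|n IH] x; first by rewrite nsq0 mulr_ge0 ?sqr_ge0 ?nsq_ge0.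
  rewrite YS nsqZr; have := nsqD_le (K x) (Y_ n (Y_ n x)).
  have := Kb x; have := IH x; have := IH (Y_ n x); have := nsq_ge0 x.
  have := nsq_ge0 (Y_ n x); move: q21 (sqr_ge0 q); set Q := q ^+ 2.
  by nra.
have Ys n : selfadj (Y_ n).
  elim: n => [|n IH] x y; first by rewrite !opE !ripE.
  by rewrite !YS !ripE Ks !IH.
(* [Y_ n.+1 - Y_ m.+1] is half of [Y_n (Y_n - Y_m) + (Y_n - Y_m) Y_m]. *)
have YC n j x : nsq (Y_ (n + j)%N x - Y_ n x) <= (q ^+ 2) ^+ n * nsq x.
  elim: n x => [|n IH] x.
    rewrite subr0 mul1r (le_trans (Yb _ _))//.
    by rewrite -[leRHS]mul1r ler_wpM2r ?nsq_ge0.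
  rewrite addSn !YS -scalerBr nsqZr opprD addrACA subrr add0r.
  set A := Y_ (n + j)%N; set B := Y_ n.
  have -> : A (A x) - B (B x) = A (A x - B x) + (A (B x) - B (B x)).
    by rewrite opB addrA subrK.
  have := nsqD_le (A (A x - B x)) (A (B x) - B (B x)).
  have := le_trans (Yb _ _) (ler_wpM2l (sqr_ge0 q) (IH x)) : nsq (A (A x - B x)) <= _.
  have := le_trans (IH (B x)) (ler_wpM2l (exprn_ge0 n (sqr_ge0 q)) (Yb n x)).
  rewrite (exprS (q ^+ 2) n) -/A -/B; move: ((q ^+ 2) ^+ n) (q ^+ 2) => P Q.
  by lra.
have [Y slimY] : exists Y : 'B(H), forall x, slim (Y_ ^~ x) (Y x).
  apply: (op_slim Yb) => x; apply: cauchy_slim => e e0.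
  have cvg0 : nsq x * (q ^+ 2) ^+ n @[n --> \oo] --> (0 : R).
    rewrite -[X in _ --> X](mulr0 (nsq x)); apply: cvgMcst; apply: cvg_expr.
    by rewrite ger0_norm ?sqr_ge0// expr_lt1.
  have [N _ hN] : \forall n \near \oo, nsq x * (q ^+ 2) ^+ n < e.
    by apply: cvgr_lt cvg0 _ _.
  exists N => n Nn; rewrite -(subnKC Nn) (le_lt_trans (YC _ _ _))// mulrC.
  exact: hN (leqnn N).
have Ysa : selfadj Y.
  move=> x y; have h1 := @slim_ripl _ _ _ _ y (slimY x).
  have h2 := @slim_ripl _ _ _ _ x (slimY y).
  apply: (@cvg_unique _ (@Rhausdorff R) (rip (Y_ n x) y @[n --> \oo])) => //.
  by rewrite (ripC x); apply: cvg_ext h2 => n; rewrite ripC -Ys.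
exists Y; split=> // [x|D DK].
  apply: rip_ext => z.
  have h1 : rip (K x + Y_ n (Y_ n x)) z @[n --> \oo] --> rip (K x + Y (Y x)) z.
    rewrite ripDl Ysa.
    apply: (@cvg_ext _ (fun n => rip (K x) z + rip (Y_ n x) (Y_ n z))).
      by move=> n; rewrite ripDl -Ys.
    exact: (cvgD (@cvg_cst _ (rip (K x) z) nat \oo _) (slim_rip (slimY x) (slimY z))).
  have h2 : rip (K x + Y_ n (Y_ n x)) z @[n --> \oo] --> rip (2%:C *: Y x) z.
    have h := @slim_ripl _ _ _ _ z (slimZ 2%:C (slimY x)).
    move: h; rewrite -cvg_shiftS; apply: cvg_ext => n.
    by rewrite YS scalerA -rmorphM divff ?scale1r// pnatr_eq0.
  exact: (@cvg_unique _ (@Rhausdorff R)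
    (rip (K x + Y_ n (Y_ n x)) z @[n --> \oo])).
have DY_ n : D * Y_ n = Y_ n * D.
  elim: n => [|n IH]; first by rewrite mulr0 mul0r.
  have IHx x : D (Y_ n x) = Y_ n (D x) := op_eqx x IH.
  have DKx x : D (K x) = K (D x) := op_eqx x DK.
  by apply: bounded_op_eqP => x; rewrite !op_mulE !YS opZ opD DKx !IHx.
apply: bounded_op_eqP => x; rewrite !opE.
apply: slim_unique (slim_op D (slimY x)) _.
have -> : D \o (Y_ ^~ x) = Y_ ^~ (D x).
  by apply/funext => n; exact: op_eqx x (DY_ n).
exact: slimY.
Qed.

Lemma invertible_square C : invertible_op (C * C) -> @invertible_op R H C.
Proof.
move=> [S [SCC CCS]]; have SC : S * C = C * S.
  by rewrite -[LHS]mulr1 -CCS -!mulrA (mulrA C C) (mulrA S) SCC mul1r.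
by exists (S * C); split; [rewrite -mulrA | rewrite SC mulrA].
Qed.

(** After scaling [B] to [B / m <= 1], invertibility bounds [B / m] below by
    some [c > 0], so [K = 1 - B / m] has a [Y] as in [quadratic_fixpoint], and
    [(1 - Y) ^ 2 = 1 - K]. *)
Lemma pos_sqrt B : selfadj B -> pos B -> invertible_op B ->
  exists C, [/\ selfadj C, C * C = B, invertible_op C &
    forall D, D * B = B * D -> D * C = C * D].
Proof.
move=> Bs Bp Bi; have [S [SB BS]] := Bi.
have [M M0 BM] := op_bounded B; have [N N0 SN] := op_bounded S.
pose m := Num.sqrt M; have m0 : 0 < m by rewrite sqrtr_gt0.
have mM : m ^+ 2 = M by rewrite sqr_sqrtr// ltW.
have Bm x : rip (B x) x <= m * nsq x.
  rewrite -(ler_pXn2r (n := 2))// ?nnegrE ?mulr_ge0 ?nsq_ge0 ?(ltW m0)//.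
  rewrite (le_trans (rip_CS _ _))// exprMn mM expr2 mulrA.
  by rewrite ler_wpM2r ?nsq_ge0.
have Blb x : nsq x <= N * m * rip (B x) x.
  have := SN (B x); rewrite -op_mulE SB => /le_trans; apply.
  by rewrite -mulrA ler_wpM2l ?(ltW N0)//; exact: pos_nsq_le.
pose c := (N * m ^+ 2 + 1)^-1.
have Nm : 0 < N * m ^+ 2 by rewrite mulr_gt0// exprn_gt0.
have c0 : 0 < c by rewrite invr_gt0; lra.
have c1 : c <= 1 by rewrite invf_le1; lra.
pose K : 'B(H) := 1 - (m^-1)%:C *: B.
have KE x : K x = x - (m^-1)%:C *: B x by [].
have mV : m * m^-1 = 1 by rewrite divff ?gt_eqF.
have [|||x|Y [Ys KY Yc]] := @quadratic_fixpoint K (1 - c).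
- by lra.
- by move=> x y; rewrite !KE !ripE Bs.
- move=> x; rewrite KE !ripE -/(nsq x).
  have := Bm x; rewrite -(ler_pM2l (_ : 0 < m^-1)) ?invr_gt0// mulrA.
  by rewrite mulVf ?gt_eqF// mul1r subr_ge0.
- rewrite KE !ripE -/(nsq x) mulrBl mul1r lerB//.
  have cNm : c * (N * m ^+ 2) = 1 - c.
    have : c * (N * m ^+ 2 + 1) = 1 by rewrite mulVf// gt_eqF//; lra.
    by lra.
  have -> : m^-1 * rip (B x) x = c * (N * m * rip (B x) x) + c * (m^-1 * rip (B x) x).
    transitivity ((c * (N * m ^+ 2) + c) * (m^-1 * rip (B x) x)).
      by rewrite cNm subrK mul1r.
    have -> : N * m * rip (B x) x = N * m ^+ 2 * (m^-1 * rip (B x) x).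
      by rewrite -[in LHS](mul1r (rip _ _)) -mV; ring.
    by ring.
  rewrite ler_wpDr// ?ler_wpM2l ?(ltW c0)// !mulr_ge0 ?(ltW c0)//.
  by rewrite invr_ge0 ltW.
pose C : 'B(H) := (Num.sqrt m)%:C *: (1 - Y).
have CE x : C x = (Num.sqrt m)%:C *: (x - Y x) by [].
have CC : C * C = B.
  apply: bounded_op_eqP => x; rewrite op_mulE !CE opZ opB -scalerBr scalerA.
  rewrite -rmorphM -expr2 sqr_sqrtr ?(ltW m0)// opprB.
  apply: rip_ext => z; have := congr1 (rip ^~ z) (KY x).
  rewrite KE !ripE => e.
  rewrite -[RHS]mul1r -mV -mulrA; congr (_ * _).
  by lra.
exists C; split=> //.
- by move=> x y; rewrite !CE !ripE Ys.
- by apply: invertible_square; rewrite CC.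
- move=> D DB; have DBx x : D (B x) = B (D x) := op_eqx x DB.
  have DK : D * K = K * D.
    by apply: bounded_op_eqP => x; rewrite !op_mulE !KE opB opZ DBx.
  have DYx x : D (Y x) = Y (D x) := op_eqx x (Yc D DK).
  by apply: bounded_op_eqP => x; rewrite !op_mulE !CE opZ opB DYx.
Qed.
End SquareRoot.

(** * Completely positive maps; homomorphisms are extreme *)

Section UCP.
Context {R : realType} {A : comCStarAlgType R} {H : hilbertType R}.
Implicit Types (a b : A) (x y z : H) (S T U C : 'B(H)) (phi psi : A -> 'B(H)).

Lemma op_sumE I (r : seq I) (P : pred I) (F : I -> 'B(H)) x :
  (\sum_(i <- r | P i) F i) x = \sum_(i <- r | P i) F i x.
Proof. by elim/big_rec2: _ => // i y S _ <-. Qed.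

Lemma rip_suml I (r : seq I) (P : pred I) (F : I -> H) y :
  rip (\sum_(i <- r | P i) F i) y = \sum_(i <- r | P i) rip (F i) y.
Proof.
by elim/big_rec2: _ => [|i u v _ <-]; rewrite ?rip0l// ripDl.
Qed.

Lemma inner_suml I (r : seq I) (P : pred I) (F : I -> H) y :
  inner (\sum_(i <- r | P i) F i) y = \sum_(i <- r | P i) inner (F i) y.
Proof.
by elim/big_rec2: _ => [|i u v _ <-]; rewrite ?inner0l// innerDl.
Qed.

Lemma inner_sumr I (r : seq I) (P : pred I) (F : I -> H) y :
  inner y (\sum_(i <- r | P i) F i) = \sum_(i <- r | P i) inner y (F i).
Proof.
rewrite innerC inner_suml rmorph_sum; apply: eq_bigr => i _.
by rewrite [RHS]innerC.
Qed.

Lemma star_mul a b : star (a * b) = star b * star a.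
Proof. exact: starM. Qed.

Lemma star1 : star (1 : A) = 1.
Proof.
have := star_mul (star 1) 1.
by rewrite mulr1 !starK mulr1 => <-.
Qed.

Section Linear.
Variables (phi : A -> 'B(H)) (phiL : linear phi).
HB.instance Definition _ := GRing.isLinear.Build R[i] A 'B(H) *:%R phi phiL.
Lemma lin0 : phi 0 = 0. Proof. exact: linear0. Qed.
Lemma linD a b : phi (a + b) = phi a + phi b. Proof. exact: linearD. Qed.
Lemma linB a b : phi (a - b) = phi a - phi b. Proof. exact: linearB. Qed.
Lemma lin_sum I (r : seq I) (P : pred I) (F : I -> A) :
  phi (\sum_(i <- r | P i) F i) = \sum_(i <- r | P i) phi (F i).
Proof. exact: linear_sum. Qed.
End Linear.

Definition row_form phi n (c : 'I_n -> A) (x : 'I_n -> H) : R[i] :=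
  \sum_i \sum_j inner (phi (star (c i) * c j) (x j)) (x i).

(** A matrix [b^* b] is the sum, over the rows [c] of [b], of the matrices
    [c^* c]; so complete positivity has to be tested on single rows only. *)
Lemma completely_positiveP phi : linear phi ->
  completely_positive phi <->
  (forall n (c : 'I_n -> A) (x : 'I_n -> H), 0 <= row_form phi c x).
Proof.
move=> phiL; split=> [cp [|n] c x|rp n _ [b ->] x].
- by rewrite /row_form big_ord0.
- pose b : 'M[A]_n.+1 := \matrix_(i, j) if i == 0 then c j else 0.
  have := cp _ (mxstar b *m b) (ex_intro _ b erefl) x.
  congr (0 <= _); apply: eq_bigr => i _; rewrite inner_suml.
  apply: eq_bigr => j _; rewrite mxE; congr (inner (phi _ _) _).
  rewrite mxE (bigD1 0)//= big1 => [|k /negPf k0]; rewrite !mxE ?k0 ?mulr0//.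
  by rewrite addr0.
- rewrite (_ : \sum_i _ = \sum_k row_form phi (b k) x); first exact: sumr_ge0.
  rewrite /row_form exchange_big; apply: eq_bigr => i _.
  rewrite inner_suml exchange_big; apply: eq_bigr => j _.
  rewrite -inner_suml -op_sumE -lin_sum// mxE; congr (inner (phi _ _) _).
  by rewrite mxE; apply: eq_bigr => k _; rewrite !mxE.
Qed.

Lemma cp_pos phi b x : linear phi -> completely_positive phi ->
  0 <= inner (phi (star b * b) x) x.
Proof.
move=> phiL /completely_positiveP-/(_ phiL _ (fun=> b) (fun=> x)).
by move=> /(_ 1%N); rewrite /row_form !big_ord1.
Qed.

Lemma inner_ge0_rip x y : 0 <= inner x y -> 0 <= rip x y.
Proof. by rewrite lecE => /andP[]. Qed.

Lemma cp_rip_ge0 phi b x : linear phi -> completely_positive phi ->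
  0 <= rip (phi (star b * b) x) x.
Proof. by move=> phiL cp; apply/inner_ge0_rip/cp_pos. Qed.

(** Complete positivity on the single row [(1, a)], from which both symmetry and
    the Kadison-Schwarz inequality are read off. *)
Lemma cp_row2 phi a x y : linear phi -> completely_positive phi ->
  0 <= inner (phi 1 x) x + inner (phi a y) x
     + (inner (phi (star a) x) y + inner (phi (star a * a) y) y).
Proof.
move=> phiL /completely_positiveP-/(_ phiL 2%N (fun i => if i == 0 then 1 else a)
  (fun i => if i == 0 then x else y)).
by rewrite /row_form !big_ord_recl !big_ord0 /= !addr0 star1 !mul1r mulr1.
Qed.

(** The imaginary part of the form in [cp_row2] vanishes; polarizing in [x] and
    [y] turns this into the adjoint relation. *)
Lemma cp_star phi a : linear phi -> completely_positive phi ->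
  adjoint (phi a) = phi (star a).
Proof.
move=> phiL cp; apply: adjoint_unique => y x.
have real z w : rip ('i%C *: phi a z) w + rip ('i%C *: phi (star a) w) z = 0.
  have im (u v : H) : 0 <= inner u v -> rip ('i%C *: u) v = 0.
    by move=> /ger0_Im; rewrite Im_inner => /eqP; rewrite oppr_eq0 => /eqP.
  have := ger0_Im (cp_row2 a w z phiL cp); rewrite !raddfD /= !Im_inner.
  have := im _ _ (cp_pos 1 w phiL cp); rewrite star1 mul1r => ->.
  by rewrite (im _ _ (cp_pos a z phiL cp)); lra.
have := real ('i%C *: y) x; rewrite opZ scalerA -expr2 sqr_i scaleN1r ripNl.
rewrite [X in _ + X](_ : _ = rip (phi (star a) x) y); last first.
  by rewrite ripZ_conj scalerA; congr rip; rewrite -[RHS]scale1r; congr (_ *: _); simpc.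
by rewrite ripC => /eqP; rewrite addrC subr_eq0 => /eqP; rewrite ripC => ->.
Qed.

(** The form in [cp_row2] at the vector [(- phi a x, x)]. *)
Lemma kadison_schwarz phi a x : ucp phi ->
  nsq (phi a x) <= rip (phi (star a * a) x) x.
Proof.
move=> [phiL phi1 cp].
have := cp_row2 a (- phi a x) x phiL cp; rewrite lecE => /andP[_].
rewrite !raddfD /= -!/(rip _ _) phi1 op_oneE !ripE opN !ripE -(cp_star _ phiL cp).
by rewrite -rip_adjr -/(nsq _); lra.
Qed.

(** A unital completely positive multiplicative map intertwines every term of
    a C*-convex decomposition of itself: the Kadison-Schwarz defects bound
    [sum_i |phi_i(a) T_i x - T_i phi(a) x| ^ 2] by
    [<phi(a^* a) x, x> - |phi(a) x| ^ 2 = 0]. *)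
Lemma homomorphism_intertwines n phi (phi_ : 'I_n -> A -> 'B(H))
    (T : 'I_n -> 'B(H)) : star_homomorphism phi ->
  (forall i, ucp (phi_ i)) -> \sum_(i < n) adjoint (T i) * T i = 1 ->
  (forall a, phi a = \sum_(i < n) adjoint (T i) * phi_ i a * T i) ->
  forall i a, phi_ i a * T i = T i * phi a.
Proof.
move=> [phiL phiM phiS] ucp_ T1 phiE i a; apply: bounded_op_eqP => x.
pose y := phi a x; rewrite !op_mulE -/y; apply/subr0_eq/nsq_eq0.
have sumT (S_ : 'I_n -> 'B(H)) u v :
    \sum_i rip (S_ i (T i u)) (T i v)
    = rip ((\sum_i adjoint (T i) * S_ i * T i) u) v.
  by rewrite op_sumE rip_suml; apply: eq_bigr => j _; rewrite -rip_adjr.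
have sum1 : \sum_i nsq (T i y) = nsq y.
  transitivity (rip ((1 : 'B(H)) y) y) => //.
  by rewrite -T1 op_sumE rip_suml; apply: eq_bigr => j _; rewrite -rip_adjr.
have defect j : nsq (phi_ j a (T j x) - T j y) <=
    rip (phi_ j (star a * a) (T j x)) (T j x)
    - 2 * rip (phi_ j a (T j x)) (T j y) + nsq (T j y).
  by rewrite nsqB lerD2r lerD2r kadison_schwarz.
have sum0 : \sum_j nsq (phi_ j a (T j x) - T j y) = 0.
  apply/eqP; rewrite eq_le sumr_ge0 ?andbT => [|j _]; last exact: nsq_ge0.
  apply: le_trans (ler_sum _ (fun j _ => defect j)) _.
  rewrite !big_split /= sumrN -mulr_sumr !sumT -!phiE sum1.
  by rewrite phiM phiS op_mulE -rip_adjr -/y -/(nsq y); lra.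
by apply: (psumr_eq0P _ sum0) => // j _; exact: nsq_ge0.
Qed.

(** [C] is the absolute value of [T], and [T * Ci] the unitary factor: it is
    isometric and has a right inverse, so its adjoint is a two-sided inverse. *)
Lemma polar T : invertible_op T -> exists C Ci : 'B(H),
  [/\ selfadj C, selfadj Ci, C * C = adjoint T * T, Ci * C = 1 & C * Ci = 1] /\
  unitary_op (T * Ci) /\
  forall S, S * (adjoint T * T) = adjoint T * T * S -> S * C = C * S.
Proof.
move=> [S [ST TS]]; pose B := adjoint T * T.
have BE x y : rip (B x) y = rip (T x) (T y) by rewrite op_mulE -rip_adjr.
have Bi : invertible_op B.
  exists (S * adjoint S); rewrite /B; split.
    by rewrite -mulrA (mulrA (adjoint S)) -adjointM TS adjoint1 mul1r.
  by rewrite -mulrA (mulrA T) TS mul1r -adjointM ST adjoint1.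
have [||C [Cs CC [Ci [CiC CCi]] comm]] := @pos_sqrt _ _ B _ _ Bi.
- by move=> x y; rewrite BE ripC -BE ripC.
- by move=> x; rewrite BE nsq_ge0.
have Cis : selfadj Ci.
  move=> x y; have CE z : C (Ci z) = z := op_eqx z CCi.
  by rewrite -[in LHS](CE y) -Cs CE.
exists C, Ci; split=> //; split=> //.
have U1 : adjoint (T * Ci) * (T * Ci) = 1.
  rewrite adjointM (selfadj_adjoint Cis) -mulrA (mulrA (adjoint T)) -/B -CC.
  by rewrite !mulrA CiC mul1r CCi.
have U2 : T * Ci * (C * S) = 1.
  by rewrite -mulrA (mulrA Ci) CiC mul1r TS.
split=> //; have -> : adjoint (T * Ci) = C * S => //.
by rewrite -[LHS]mulr1 -U2 (mulrA (adjoint _)) U1 mul1r.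
Qed.

(** Taking adjoints in the intertwining relation shows that [phi] commutes with
    [T_i^* T_i], hence with its square root. *)
Lemma homomorphism_extreme phi : ucp phi -> star_homomorphism phi ->
  cstar_extreme phi.
Proof.
move=> phiU phiH; split=> // n phi_ T ucp_ Ti T1 phiE i.
have inter a := homomorphism_intertwines phiH ucp_ T1 phiE i a.
have [phiL phiM phiS] := phiH; have [lin_i _ cp_i] := ucp_ i.
have inter' a : adjoint (T i) * phi_ i a = phi a * adjoint (T i).
  rewrite -(starK a) phiS -(cp_star _ lin_i cp_i) -!adjointM.
  by rewrite -[in RHS]inter.
have [C [Ci [[Cs Cis CC CiC CCi] [U comm]]]] := polar (Ti i).
exists (T i * Ci) => // a.
have phiC : phi a * C = C * phi a.
  by apply: comm; rewrite mulrA -inter' -!mulrA inter.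
rewrite adjointM (selfadj_adjoint Cis) -!mulrA (mulrA (phi_ i a)) inter.
by rewrite !mulrA -(mulrA Ci) -CC !mulrA CiC mul1r -phiC -mulrA CCi mulr1.
Qed.
End UCP.

(** * Extremality and domination *)

Section Domination.
Context {R : realType} {A : comCStarAlgType R} {H : hilbertType R}.
Implicit Types (a b : A) (x y z : H) (S T U C : 'B(H)) (phi psi : A -> 'B(H)).

Lemma linear_conj phi S : linear phi -> linear (fun a => adjoint S * phi a * S).
Proof.
move=> phiL k a b; rewrite phiL; apply: bounded_op_eqP => x.
by rewrite !opE opD opZ.
Qed.

Lemma cp_conj phi S : linear phi -> completely_positive phi ->
  completely_positive (fun a => adjoint S * phi a * S).
Proof.
move=> phiL /completely_positiveP cp; apply/completely_positiveP.
  exact: linear_conj.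
move=> n c x; have := cp phiL n c (S \o x); congr (0 <= _).
apply: eq_bigr => i _; apply: eq_bigr => j _; rewrite !op_mulE /=.
by apply/esym/rip_inner_adj => u v; rewrite -rip_adjr.
Qed.

Lemma selfadj_adjointP T : adjoint T = T -> selfadj T.
Proof. by move=> TT x y; rewrite rip_adj TT. Qed.

(** [psi] becomes unital when conjugated by the inverse square root of [psi 1]. *)
Lemma cp_normalize psi : linear psi -> completely_positive psi ->
  invertible_op (psi 1) ->
  exists C Ci phi, [/\ ucp phi, selfadj C, C * C = psi 1,
    Ci * C = 1 /\ C * Ci = 1 & forall a, psi a = adjoint C * phi a * C].
Proof.
move=> psiL cp inv; have [||C [Cs CC [Ci [CiC CCi]] _]] := pos_sqrt _ _ inv.
- by apply: selfadj_adjointP; rewrite (cp_star _ psiL cp) star1.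
- by move=> x; have := cp_rip_ge0 1 x psiL cp; rewrite mulr1 star1.
have Ca : adjoint Ci * C = 1.
  by rewrite -[C](selfadj_adjoint Cs) -adjointM CCi adjoint1.
exists C, Ci, (fun a => adjoint Ci * psi a * Ci); split=> // [|a].
  split; [exact: linear_conj | | exact: cp_conj].
  by rewrite -CC mulrA Ca mul1r.
rewrite (selfadj_adjoint Cs) -!mulrA CiC mulr1 mulrA.
have -> : adjoint Ci = Ci by rewrite -[LHS]mulr1 -CCi mulrA Ca mul1r.
by rewrite CCi mul1r.
Qed.

(** Normalizing both terms of [phi = psi + (phi - psi)] gives a C*-convex
    decomposition of [phi], and extremality makes its first term unitarily
    equivalent to [phi]. *)
Lemma extreme_dominated phi psi : cstar_extreme phi ->
  linear psi -> completely_positive psi ->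
  completely_positive (fun a => phi a - psi a) ->
  invertible_op (psi 1) -> invertible_op (1 - psi 1) ->
  exists2 S, invertible_op S & forall a, phi a = adjoint S * psi a * S.
Proof.
move=> [[phiL phi1 phicp] ext] psiL cp cp' inv inv'.
have psiL' : linear (fun a => phi a - psi a).
  by move=> k a b; rewrite phiL psiL scalerBr opprD addrACA.
have [C [Ci [chi [chiU Cs CC [CiC CCi] chiE]]]] := cp_normalize psiL cp inv.
have [|C' [Ci' [chi' [chiU' Cs' CC' [CiC' CCi'] chiE']]]] :=
  cp_normalize psiL' cp'; first by rewrite phi1.
have [||||U [U1 U2] UE] := ext 2%N (fun i => if i == 0 then chi else chi')
    (fun i => if i == 0 then C else C') _ _ _ _ 0.
- by move=> i; case: ifP.
- by move=> i; case: ifP => _; [exists Ci | exists Ci'].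
- rewrite !big_ord_recl big_ord0 /= addr0 !selfadj_adjoint// CC CC' phi1.
  by rewrite addrC subrK.
- by move=> a; rewrite !big_ord_recl big_ord0 /= addr0 -chiE -chiE' addrC subrK.
exists (Ci * U) => [|a].
  exists (adjoint U * C); split.
    by rewrite -mulrA (mulrA C) CCi mul1r.
  by rewrite -mulrA (mulrA U) U2 mul1r.
rewrite UE /= chiE !adjointM -!mulrA (mulrA C Ci) CCi mul1r.
by rewrite (mulrA (adjoint Ci)) -adjointM CCi adjoint1 mul1r.
Qed.
End Domination.

(** * Rank one operators *)

Section RankOne.
Context {R : realType} {H : hilbertType R}.
Implicit Types (x y z v w : H) (k : R) (S T : 'B(H)).

Lemma selfadj_im T x : selfadj T -> rip ('i%C *: x) (T x) = 0.
Proof.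
move=> Ts; have : rip ('i%C *: x) (T x) = - rip ('i%C *: x) (T x); last by lra.
rewrite {1}(_ : rip _ _ = rip ('i%C *: T x) x); last by rewrite -opZ Ts.
rewrite ripZ_conj ripC -ripNl -scaleNr; congr (rip (_ *: _) _).
by simpc.
Qed.

(** The squared modulus of [inner y v]. *)
Definition absq v y : R := rip y v ^+ 2 + rip ('i%C *: y) v ^+ 2.

Lemma innerE y v : inner y v = (rip y v) +i* (- rip ('i%C *: y) v).
Proof. by rewrite -Im_inner /rip; case: (inner y v). Qed.

Lemma selfadj_inner_ge0 T y : selfadj T -> pos T -> 0 <= inner (T y) y.
Proof.
move=> Ts Tp; rewrite innerC innerE selfadj_im// oppr0 -Ts.
by rewrite (_ : Num.conj _ = (rip (T y) y)%:C) ?ler0c//; exact: conjc_real.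
Qed.

(** The phase of [inner y v] can be moved into [y], so a bound on the real part
    of [inner y v] by a form bounds its modulus as well. *)
Lemma absq_le T v : selfadj T -> (forall y, rip y v ^+ 2 <= rip (T y) y) ->
  forall y, absq v y <= rip (T y) y.
Proof.
move=> Ts le_T y; have := le_T ((rip y v +i* rip ('i%C *: y) v) *: y).
have conjM (p q : R) : (p +i* q)^* * (p +i* q) = (p ^+ 2 + q ^+ 2)%:C.
  by simpc; congr (_ +i* _); ring.
rewrite [X in _ <= X](_ : _ = absq v y * rip (T y) y); last first.
  by rewrite opZ ripZ_conj scalerA conjM ripZr.
rewrite [X in X ^+ 2](_ : _ = absq v y); last first.
  by rewrite {1}/rip innerZl innerE /=; rewrite /absq; ring.
have := sqr_ge0 (rip y v); have := sqr_ge0 (rip ('i%C *: y) v).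
rewrite -/(absq v y); have [->|] := eqVneq (absq v y) 0.
  by move=> _ _ _; apply: le_trans (le_T y); exact: sqr_ge0.
move=> p0 h1 h2; have pp : 0 < absq v y by rewrite lt_neqAle eq_sym p0 addr_ge0.
by rewrite expr2 ler_pM2l.
Qed.

Fact rankone_subproof v :
  (fun y => inner y v *: v) \in @bounded_op_pred R H.
Proof.
apply: (@bounded_op_real _ _ _ (nsq v)).
  by move=> c x y; rewrite innerDl innerZl scalerDl scalerA.
move=> y; rewrite nsqZ innerE /= sqrrN -/(absq v y) expr2 -mulrA mulrC.
rewrite ler_wpM2l ?nsq_ge0//; have vs : selfadj ((nsq v)%:C *: (1 : 'B(H))).
  by apply: selfadjZ.
have := absq_le vs _ y; rewrite !opE ripZl; apply=> x.
by rewrite !opE ripZl mulrC rip_CS.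
Qed.
Definition rankone v := BoundedOp (rankone_subproof v).

Lemma rankoneE v y : rankone v y = inner y v *: v. Proof. by []. Qed.

Lemma rankone_rip v y : rip (rankone v y) y = absq v y.
Proof.
by rewrite rankoneE /rip innerZl (innerC v) innerE /absq /Num.conj /=; ring.
Qed.

Lemma rankone_selfadj v : selfadj (rankone v).
Proof.
move=> x y; rewrite !rankoneE (ripC x) /rip !innerZl (innerC v x) (innerC v y).
by case: (inner x v) (inner y v) => a b [c d]; rewrite /Num.conj /=; ring.
Qed.

Lemma rankone_eigen v : rankone v v = (nsq v)%:C *: v.
Proof. by rewrite rankoneE innerxx. Qed.

Lemma rankone_sq v : rankone v * rankone v = (nsq v)%:C *: rankone v.
Proof.
apply: bounded_op_eqP => y; rewrite !opE [in RHS]rankoneE.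
by rewrite [X in rankone v X]rankoneE opZ rankone_eigen !scalerA mulrC.
Qed.

Lemma invertible_rankone v k : 1 + k * nsq v != 0 ->
  invertible_op (1 + k%:C *: rankone v).
Proof.
move=> k0.
(* The inverse has the same form, since [rankone v] squares to a multiple of
   itself. *)
pose l := - k / (1 + k * nsq v).
have kl : k + l + k * l * nsq v = 0.
  have : l * (1 + k * nsq v) = - k by rewrite divfK.
  by lra.
have PP y : rankone v (rankone v y) = (nsq v)%:C *: rankone v y.
  exact: op_eqx (rankone_sq v).
have main s t : s + t + s * t * nsq v = 0 ->
    (1 + s%:C *: rankone v) * (1 + t%:C *: rankone v) = 1.
  move=> st; apply: bounded_op_eqP => y; rewrite !opE opD opZ PP.
  rewrite scalerDr !scalerA -!rmorphM /= -!addrA; rewrite -[RHS]addr0.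
  congr (_ + _); rewrite -!scalerDl -!rmorphD /= (_ : _ + _ = 0) ?scale0r//.
  by rewrite -[RHS]st; ring.
exists (1 + l%:C *: rankone v); split; apply: main => //.
by rewrite -[RHS]kl; ring.
Qed.

Lemma invertible_scale k T : k != 0 -> invertible_op T ->
  invertible_op (k%:C *: T).
Proof.
move=> k0 [S [ST TS]]; exists ((k^-1)%:C *: S).
have kk : (k^-1)%:C * k%:C = 1 :> R[i] by rewrite -rmorphM mulVf.
split; apply: bounded_op_eqP => x; rewrite !opE opZ scalerA.
  by rewrite kk scale1r -op_mulE ST.
by rewrite mulrC kk scale1r -op_mulE TS.
Qed.
End RankOne.

(** * Perturbing a positive contraction that is not idempotent *)

Section Perturbation.
Context {R : realType} {H : hilbertType R}.
Implicit Types (x y z v w : H) (k t : R) (S T E : 'B(H)).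

Lemma dense_nsq (D : set H) x e : dense D -> 0 < e ->
  exists2 d, D d & nsq (d - x) < e.
Proof.
move=> dD e0; have s0 : 0 < (Num.sqrt e)%:C by rewrite ltcR sqrtr_gt0.
have [|d [xd Dd]] := dD (ball x (Num.sqrt e)%:C) _ (@ball_open _ _ x _).
  by exists x; exact: ballxx.
exists d => //; move: xd; rewrite -ball_normE /ball_ /= => xd.
have : `|x - d| ^+ 2 < (Num.sqrt e)%:C ^+ 2 by rewrite ltr_pXn2r ?nnegrE ?(ltW s0).
by rewrite norm_sqE -rmorphXn ltcR sqr_sqrtr ?(ltW e0)// -nsqN opprB.
Qed.

(** Unit eigenvectors for distinct eigenvalues are orthogonal, hence at distance
    [sqrt 2], and a dense countable set separates them. *)
Lemma countable_eigenvalues E : separable_space H -> selfadj E ->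
  countable [set t | exists2 x, x != 0 & E x = t%:C *: x].
Proof.
move=> [D cD dD] Es; set B := [set t | _].
have unit t : B t -> exists2 x, nsq x = 1 & E x = t%:C *: x.
  move=> [x x0 Ex]; exists ((Num.sqrt (nsq x))^-1%:C *: x).
    by rewrite nsqZr exprVn sqr_sqrtr ?nsq_ge0// mulVf// gt_eqF// nsq_gt0.
  by rewrite opZ Ex !scalerA mulrC.
have /choice[d dP] t : exists d, B t -> D d /\
    exists x, [/\ nsq x = 1, E x = t%:C *: x & nsq (d - x) < 4^-1].
  have [Bt|nBt] := pselect (B t); last by exists 0.
  have [x x1 Ex] := unit t Bt.
  by have [|d Dd dx] := @dense_nsq D x 4^-1 dD; [lra | exists d; split; [|exists x]].
have /countable_injP[f finj] := cD.
apply/countable_injP; exists (f \o d) => s t; rewrite !inE => Bs Bt /= fst.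
have [Ds [x [x1 Ex xs]]] := dP s Bs; have [Dt [y [y1 Ey yt]]] := dP t Bt.
have dst : d s = d t by apply: finj; rewrite ?inE.
apply/eqP; apply: contraT => st.
have xy : rip x y = 0.
  have := Es x y; rewrite Ex Ey ripZl ripZr => /eqP.
  by rewrite -subr_eq0 -mulrBl mulf_eq0 subr_eq0 (negPf st)/= => /eqP.
have := nsqD_le (x - d s) (d s - y); rewrite addrA subrK (nsqB x y) xy x1 y1.
by rewrite -(nsqN (x - d s)) opprB {2}dst; lra.
Qed.

Lemma avoid_countable (B : set R) e : countable B -> 0 < e ->
  exists2 t, 0 < t < e & ~ B t.
Proof.
move=> cB e0; apply: contrapT => nB.
have sub : `]0, e[%classic `<=` B.
  move=> t /=; rewrite in_itv/= => te; apply: contrapT => nBt.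
  by apply: nB; exists t.
have := countable_lebesgue_measure0 (sub_countable (subset_card_le sub) cB).
by rewrite lebesgue_measure_itv/= lte_fin e0 sube0 => -[] e00; rewrite e00 ltxx in e0.
Qed.

(** If [0 <= E <= 1] is not idempotent, some vector [z] has moments
    [m_j = <E ^ j z, z>] with [m_4 < m_3]. For [l > 0] put [M = E - l (1 - E)].
    The rank one operator [P = v v^*] with [v] proportional to [E M z], scaled so
    that [P] and [M] agree at [w = E z], makes [w] a null vector of
    [M - P = (E - P) - l (1 - E)]. The scaling is possible when [<E M z, E z>],
    which is [m_3] at [l = 0], is positive. By Cauchy-Schwarz for the form of [E],
    [P <= E] follows from [<E M z, M z> <= <E M z, E z>], and [|v| < 1] means
    [|E M z| ^ 2 < <E M z, E z>]. The differences of the two sides are [l] and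
    [1 + l] times quantities that take the values [m_2 - m_3] and [m_3 - m_4] at
    [l = 0]. All these values are positive, so every small [l > 0] is suitable,
    and [l / (1 + l)] can be made to avoid the eigenvalues of [E]. *)
Lemma rankone_perturbation E : separable_space H -> selfadj E -> pos E ->
  (forall x, rip (E x) x <= nsq x) -> E * E <> E ->
  exists v l w, [/\ forall y, absq v y <= rip (E y) y, nsq v < 1,
    w != 0, E w - rankone v w = l%:C *: (w - E w) &
    forall x, E x = l%:C *: (x - E x) -> x = 0].
Proof.
move=> sepH Es Ep E1 nE.
(* Otherwise [N = E - E ^ 2 >= 0] vanishes on the range of [E], so [N ^ 2 = 0]. *)
have [z zE] : exists z, rip (E (E (E (E z)))) z < rip (E (E (E z))) z.
  apply: contrapT => nz; apply: nE; apply: bounded_op_eqP => x; rewrite opE.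
  pose N := E - E * E.
  have NE y : N y = E y - E (E y) by [].
  have Ns : selfadj N by move=> y y'; rewrite !NE !ripE !Es.
  have Np : pos N.
    move=> y; rewrite NE; have := Ep (y - E y); have := E1 (E y).
    by rewrite /nsq !opB !ripE !Es; lra.
  have NEz y : rip (N (E y)) (E y) <= 0.
    rewrite leNgt; apply/negP => Ny; apply: nz; exists y; move: Ny.
    by rewrite NE !ripE !Es; lra.
  have NE0 y : N (E y) = 0.
    apply: nsq_eq0; apply/eqP; rewrite -sqrf_eq0 eq_le sqr_ge0 andbT.
    rewrite (le_trans (pos_CS (E y) (N (E y)) Ns Np))//.
    by rewrite mulr_le0_ge0.
  apply/esym/subr0_eq; rewrite -NE; apply: nsq_eq0.
  have NN : N (N x) = N (E (x - E x)) by rewrite opB.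
  by rewrite /nsq Ns NN NE0 rip0r.
pose m j := rip z (iter j E z); pose g := m 3 - m 4.
have gE : g = m 3 - m 4 by [].
have g0 : 0 < g by move: zE; rewrite !Es subr_gt0.
have m1 : 0 <= m 1 by rewrite /m /= ripC.
have m2 : 0 <= m 2 by rewrite /m /= -Es nsq_ge0.
have m3 : 0 <= m 3 by rewrite /m /= -Es ripC.
have m4 : 0 <= m 4 by rewrite /m /= -2!Es nsq_ge0.
have m23 : g <= m 2 - m 3.
  have := nsq_ge0 (E z - E (E z)).
  by rewrite /g /m /= nsqB /nsq !Es; lra.
pose e := g / (m 1 + m 2 + 1).
have e0 : 0 < e by rewrite divr_gt0//; lra.
pose e' := Num.min (e / 2) 2^-1.
have e'0 : 0 < e' by rewrite lt_min; apply/andP; split; lra.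
have [t /andP[t0 te'] nt] := avoid_countable (countable_eigenvalues sepH Es) e'0.
have [te t1] : t < e / 2 /\ t < 2^-1 by move: te'; rewrite lt_min => /andP[].
(* [t = l / (1 + l)], so [E x = l (x - E x)] says that [E x = t x]. *)
pose l := t / (1 - t).
have lt : l * (1 - t) = t by rewrite divfK// gt_eqF//; lra.
have l0 : 0 < l by rewrite divr_gt0//; lra.
have le : l < e.
  have : 0 < l * (2^-1 - t) by rewrite mulr_gt0// subr_gt0.
  by lra.
have lg : l * (m 1 + m 2 + 1) < g by rewrite -ltr_pdivlMr//; lra.
(* With [M = (1 + l) E - l] as above, [q = M z], [u = E M z] and
   [c = <E M z, E z>]. *)
pose u := (1 + l)%:C *: E (E z) - l%:C *: E z.
pose c := rip u (E z).
have cE : c = (1 + l) * m 3 - l * m 2 by rewrite /c /u !ripE !Es /m /=; ring.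
have uu : nsq u = (1 + l) ^+ 2 * m 4 - 2 * l * (1 + l) * m 3 + l ^+ 2 * m 2.
  by rewrite /nsq /u !ripE !Es /m /=; ring.
pose q := (1 + l)%:C *: E z - l%:C *: z.
have uq : u = E q by rewrite /u /q opB !opZ.
have qq : rip (E q) q = (1 + l) ^+ 2 * m 3 - 2 * l * (1 + l) * m 2 + l ^+ 2 * m 1.
  by rewrite -uq /u /q !ripE !Es /m /=; ring.
have [lm1 lm2 lm3] : [/\ 0 <= l * m 1, 0 <= l * m 2 & 0 <= l * m 3].
  by split; rewrite mulr_ge0// ltW.
have lm23 : 0 <= l * (m 2 - m 3) by rewrite mulr_ge0//; lra.
have lm34 : 0 < l * (m 3 - m 4) by rewrite mulr_gt0.
have c0 : 0 < c by rewrite cE; lra.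
have qc : rip (E q) q <= c.
  have : 0 <= l * ((1 + l) * (m 2 - m 3) - l * (m 1 - m 2)).
    by rewrite mulr_ge0 ?(ltW l0)//; lra.
  by rewrite qq cE; lra.
have uc : nsq u < c.
  have : 0 < (1 + l) * ((1 + l) * (m 3 - m 4) - l * (m 2 - m 3)).
    by rewrite mulr_gt0//; lra.
  by rewrite uu cE; lra.
pose s := Num.sqrt c^-1; have s2 : s ^+ 2 = c^-1 by rewrite sqr_sqrtr// invr_ge0 ltW.
exists (s%:C *: u), l, (E z); split.
- apply: absq_le => // y; rewrite ripZr exprMn s2 ler_pdivrMl// (ripC y) uq.
  by rewrite (le_trans (pos_CS _ _ Es Ep))// ler_wpM2r.
- by rewrite nsqZr s2 ltr_pdivrMl// mulr1.
- apply: contraL zE => /eqP Ez; rewrite -leNgt Ez !op0 !rip0l//.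
- have im : rip ('i%C *: E z) (s%:C *: u) = 0.
    have i1 : rip ('i%C *: E z) (E z) = 0 by apply: (@selfadj_im _ _ (1 : 'B(H))).
    by rewrite ripZr /u ripDr ripNr !ripZr selfadj_im// i1; ring.
  rewrite rankoneE innerE im oppr0 complexr0 ripZr ripC scalerA -rmorphM /=.
  rewrite mulrAC -expr2 s2 mulVf ?gt_eqF// scale1r.
  by apply: rip_ext => y; rewrite /u !ripE; ring.
- move=> x Ex; apply: contrapT => /eqP x0; apply: nt; exists x => //.
  apply: rip_ext => y; have r : rip (E x) y = l * (rip x y - rip (E x) y).
    by rewrite [in LHS]Ex !ripE.
  have : (1 - t) * rip (E x) y = l * (1 - t) * (rip x y - rip (E x) y).
    by rewrite [in LHS]r; ring.
  by rewrite lt ripZl; lra.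
Qed.
End Perturbation.

(** * Operations on completely positive maps *)

Section CompletelyPositiveMaps.
Context {R : realType} {A : comCStarAlgType R} {H : hilbertType R}.
Implicit Types (a b : A) (x y z : H) (D : 'B(H)) (phi psi : A -> 'B(H)).

Lemma linear_sub phi psi : linear phi -> linear psi -> linear (fun a => phi a - psi a).
Proof. by move=> phiL psiL k a b; rewrite phiL psiL scalerBr opprD addrACA. Qed.

Lemma linear_add phi psi : linear phi -> linear psi -> linear (fun a => phi a + psi a).
Proof. by move=> phiL psiL k a b; rewrite phiL psiL scalerDr addrACA. Qed.

Lemma linear_scale (k : R[i]) phi : linear phi -> linear (fun a => k *: phi a).
Proof. by move=> phiL l a b; rewrite phiL scalerDr !scalerA mulrC. Qed.

Lemma cp_add phi psi : completely_positive phi -> completely_positive psi ->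
  completely_positive (fun a => phi a + psi a).
Proof.
move=> cp cp' n a a0 x; have := addr_ge0 (cp n a a0 x) (cp' n a a0 x).
congr (0 <= _); rewrite -big_split; apply: eq_bigr => i _ /=.
rewrite -innerDl -big_split; congr (inner _ _); apply: eq_bigr => j _ /=.
by rewrite !mxE.
Qed.

Lemma cp_scale (k : R[i]) phi : 0 <= k -> completely_positive phi ->
  completely_positive (fun a => k *: phi a).
Proof.
move=> k0 cp n a a0 x; have := mulr_ge0 k0 (cp n a a0 x).
congr (0 <= _); rewrite mulr_sumr; apply: eq_bigr => i _ /=.
rewrite -innerZl scaler_sumr; congr (inner _ _); apply: eq_bigr => j _ /=.
by rewrite !mxE.
Qed.

Lemma cvg_sum n (f : nat -> 'I_n -> R) (l : 'I_n -> R) :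
  (forall i, f k i @[k --> \oo] --> l i) ->
  \sum_i f k i @[k --> \oo] --> \sum_i l i.
Proof. by move=> fl; apply: cvg_big => //; exact: add_continuous. Qed.

(** Nonnegativity of the real part and vanishing of the imaginary part of
    [row_form] are preserved by limits. *)
Lemma cp_slim (phi_ : nat -> A -> 'B(H)) phi :
  (forall n, linear (phi_ n)) -> (forall n, completely_positive (phi_ n)) ->
  linear phi -> (forall a y, slim (fun n => phi_ n a y) (phi a y)) ->
  completely_positive phi.
Proof.
move=> lin_ cp_ phiL lim; apply/completely_positiveP => // n c x.
pose rf d (psi : A -> 'B(H)) :=
  \sum_i \sum_j rip (d *: psi (star (c i) * c j) (x j)) (x i).
have rf_lim d : rf d (phi_ k) @[k --> \oo] --> rf d phi.
  apply: cvg_sum => i; apply: cvg_sum => j.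
  by apply: slim_ripl; apply: slimZ.
have rfE psi : row_form psi c x = rf 1 psi +i* (- rf 'i%C psi).
  have ReE : complex.Re (row_form psi c x) = rf 1 psi.
    rewrite /row_form raddf_sum; apply: eq_bigr => i _ /=.
    by rewrite raddf_sum; apply: eq_bigr => j _ /=; rewrite scale1r.
  have ImE : complex.Im (row_form psi c x) = - rf 'i%C psi.
    rewrite /row_form raddf_sum -sumrN; apply: eq_bigr => i _ /=.
    by rewrite raddf_sum -sumrN; apply: eq_bigr => j _ /=; rewrite Im_inner.
  by rewrite -ReE -ImE; case: row_form.
have cp n' : 0 <= rf 1 (phi_ n') /\ rf 'i%C (phi_ n') = 0.
  have /completely_positiveP-/(_ (lin_ n') n c x) := cp_ n'.
  by rewrite rfE lecE /= oppr_eq0 => /andP[/eqP-> ->].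
rewrite rfE lecE /=; apply/andP; split.
  have lim_i := rf_lim 'i%C; have lim_0 : rf 'i%C (phi_ k) @[k --> \oo] --> (0 : R).
    rewrite (_ : (fun k => _) = fun=> 0); first exact: cvg_cst.
    by apply/funext => k; have [] := cp k.
  rewrite oppr_eq0; apply/eqP.
  by apply: (@cvg_unique _ (@Rhausdorff R) (rf 'i%C (phi_ k) @[k --> \oo])).
by apply: cvgr_to_ge (rf_lim 1) _; apply: nearW => k; have [] := cp k.
Qed.
End CompletelyPositiveMaps.

(** * Continuous functions on a countable compact space *)

Section ComplexContinuity.
Context {R : realType}.

Lemma continuous_Re : continuous (fun z : R[i]^o => complex.Re z : R).
Proof.
move=> z; apply/(@cvgrPdist_lt _ _ _ (nbhs z) (nbhs_filter z)) => e e0.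
have e0' : 0 < e%:C by rewrite ltcR.
apply: (@filterS _ _ (@nbhs_filter R[i]^o z) _ _ _ (nbhsx_ballx z e%:C e0')) => w.
rewrite -ball_normE /ball_ /= => zw; rewrite -ltcR (le_lt_trans _ zw)//.
by rewrite (le_trans _ (normc_ge_Re _))// raddfB.
Qed.

Lemma continuous_real_complex : continuous (fun r : R => r%:C : R[i]^o).
Proof.
move=> z; apply/cvgrPdist_lt => e e0.
have [eE Re0] : e = (complex.Re e)%:C /\ 0 < complex.Re e.
  by move: e0; rewrite ltcE; case: (e) => a b /= /andP[/eqP-> ->].
apply: filterS (@nbhsx_ballx _ R z _ Re0) => w.
rewrite -ball_normE /ball_ /= => zw.
by rewrite eE -rmorphB normc_def /= expr0n addr0 sqrtr_sqr ltcR.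
Qed.
End ComplexContinuity.

Section Spectrum.
Context {R : realType} {A : comCStarAlgType R} {X : topologicalType}.
Variable G : A -> X -> R[i]^o.
Hypotheses (Xcompact : compact [set: X]) (Xhausdorff : hausdorff_space X)
  (Xcountable : countable [set: X]) (Glin : linear G) (Ginj : injective G)
  (Grange : range G = [set f : X -> R[i]^o | continuous f])
  (G1 : forall x, G 1 x = 1) (GM : forall a b x, G (a * b) x = G a x * G b x)
  (Gstar : forall a x, G (star a) x = Num.conj (G a x : R[i])).
Implicit Types (a b : A) (x z : X) (p : nat -> A).

Lemma G_continuous a : continuous (G a).
Proof.
have : range G (G a) by exists a.
by rewrite Grange.
Qed.

Lemma G_surj (f : X -> R[i]^o) : continuous f -> exists a, G a = f.
Proof.
move=> fc; have [a _ <-] : range G f by rewrite Grange.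
by exists a.
Qed.

Lemma GD a b x : G (a + b) x = G a x + G b x.
Proof. by have := Glin 1 a b; rewrite !scale1r => ->. Qed.

Lemma G0 x : G 0 x = 0.
Proof. by apply: (addrI (G 0 x)); rewrite -GD !addr0. Qed.

Lemma GZ c a x : G (c *: a) x = c * G a x.
Proof.
transitivity (c * G a x + G 0 x); last by rewrite G0 addr0.
by rewrite -[c *: a]addr0 Glin.
Qed.

Lemma GB a b x : G (a - b) x = G a x - G b x.
Proof. by rewrite GD -(scaleN1r b) GZ mulN1r. Qed.

Lemma G_ext a b : (forall x, G a x = G b x) -> a = b.
Proof. by move=> ab; apply/Ginj/funext. Qed.

Definition nonneg a := forall x, 0 <= (G a x : R[i]).

(** Nonnegative functions are squares, by continuity of the square root. *)
Lemma nonneg_square a : nonneg a -> exists2 b, star b = b & star b * b = a.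
Proof.
move=> a0.
have [|b Gb] := @G_surj (fun x => (Num.sqrt (complex.Re (G a x)))%:C).
  move=> x; apply: (continuous_comp (f := fun x => Num.sqrt (complex.Re (G a x)))
    (g := fun r => r%:C : R[i]^o)); last exact: continuous_real_complex.
  apply: (continuous_comp (f := fun x => complex.Re (G a x)));
    last exact: sqrt_continuous.
  by apply: (continuous_comp (f := G a)); [exact: G_continuous | exact: continuous_Re].
exists b.
  by apply: G_ext => x; rewrite Gstar Gb; exact: conjc_real.
apply: G_ext => x; rewrite GM Gstar Gb.
have := a0 x; rewrite lecE; case: (G a x) => r i /= /andP[/eqP-> r0].
have -> : Num.conj (Num.sqrt r)%:C = (Num.sqrt r)%:C := conjc_real _.
transitivity ((Num.sqrt r * Num.sqrt r)%:C : R[i]); first by rewrite rmorphM.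
by rewrite -expr2 sqr_sqrtr.
Qed.

Lemma urysohn_point x x' : x <> x' -> exists u, [/\ G u x = 1, G u x' = 0 &
  forall z, 0 <= (G u z : R[i]) <= 1].
Proof.
move=> xx'.
have closed1 (z : X) : closed [set z].
  exact: accessible_closed_set1 (hausdorff_accessible Xhausdorff) z.
have disj : [set x'] `&` [set x] = set0.
  by apply/seteqP; split=> // z [/= -> /esym].
have normX := compact_normal Xhausdorff Xcompact.
have := normal_uniform_separator normX (closed1 x') (closed1 x) disj.
move/(@uniform_separatorP _ R) => [f [fc f01 f0 f1]].
have [|u Gu] := @G_surj (fun z => (f z)%:C).
  move=> z; apply: (continuous_comp (f := f) (g := fun r => r%:C : R[i]^o)).
    exact: fc.
  exact: continuous_real_complex.
exists u; split=> [||z]; rewrite Gu.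
- by rewrite (f1 (f x))//; exists x.
- by rewrite (f0 (f x'))//; exists x'.
- by have := f01 (f z); rewrite /= in_itv /= ler0c lecR; apply; exists z.
Qed.

(** Nonnegative functions are handled through their real values. *)
Definition gr a x : R := complex.Re (G a x).

Lemma nonnegE a x : nonneg a -> G a x = (gr a x)%:C.
Proof. by move=> /(_ x); rewrite lecE /gr; case: (G a x) => r i /= /andP[/eqP->]. Qed.

Lemma gr_ge0 a x : nonneg a -> 0 <= gr a x.
Proof. by move=> a0; rewrite -ler0c -nonnegE. Qed.

Lemma gr1 x : gr 1 x = 1. Proof. by rewrite /gr G1. Qed.
Lemma grD a b x : gr (a + b) x = gr a x + gr b x.
Proof. by rewrite /gr GD; case: (G a x) (G b x) => ? ? []. Qed.
Lemma grB a b x : gr (a - b) x = gr a x - gr b x.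
Proof. by rewrite /gr GB; case: (G a x) (G b x) => ? ? []. Qed.
Lemma grM a b x : nonneg b -> gr (a * b) x = gr a x * gr b x.
Proof.
move=> /nonnegE; rewrite /gr GM => ->.
by case: (G a x) => r i; rewrite /= mulr0 subr0.
Qed.

Lemma nonneg1 : nonneg 1. Proof. by move=> x; rewrite G1 ler01. Qed.
Lemma nonnegM a b : nonneg a -> nonneg b -> nonneg (a * b).
Proof.
move=> a0 b0 x; rewrite GM (nonnegE _ a0) (nonnegE _ b0) -rmorphM ler0c.
by rewrite mulr_ge0// gr_ge0.
Qed.
Lemma nonnegD a b : nonneg a -> nonneg b -> nonneg (a + b).
Proof. by move=> a0 b0 x; rewrite GD addr_ge0. Qed.
Lemma nonneg_sub a b : nonneg a -> nonneg b -> (forall x, gr a x <= gr b x) ->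
  nonneg (b - a).
Proof.
by move=> a0 b0 ab x; rewrite GB (nonnegE _ a0) (nonnegE _ b0) -rmorphB ler0c subr_ge0.
Qed.
Lemma nonnegZ k a : 0 <= k -> nonneg a -> nonneg (k%:C *: a).
Proof. by move=> k0 a0 x; rewrite GZ mulr_ge0 ?ler0c. Qed.
Lemma nonneg_star a : nonneg (star a * a).
Proof. by move=> x; rewrite GM Gstar mulrC mul_conjC_ge0. Qed.
Lemma nonneg_real a : nonneg a -> star a = a.
Proof.
by move=> a0; apply: G_ext => x; rewrite Gstar (nonnegE _ a0); exact: conjc_real.
Qed.
Lemma nonneg_sum (f : nat -> A) n : (forall i, nonneg (f i)) ->
  nonneg (\sum_(0 <= i < n) f i).
Proof.
move=> f0; elim: n => [|n IH]; first by move=> x; rewrite big_geq// G0.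
by rewrite big_nat_recr//=; apply: nonnegD.
Qed.

Lemma near_gr_lt a x e : gr a x < e -> \forall z \near x, gr a z < e.
Proof.
move=> axe; have : gr a z @[z --> x] --> gr a x.
  apply: (continuous_comp (f := G a)); first exact: G_continuous.
  exact: continuous_Re.
by move/cvgr_lt; apply.
Qed.

(** Compactness, in its near-covering form. *)
Lemma uniformly_eventually (P : nat -> X -> Prop) :
  (forall x, exists N, \forall z \near x, forall n, (N <= n)%N -> P n z) ->
  exists N, forall n, (N <= n)%N -> forall z, P n z.
Proof.
move=> loc.
have [|N _ NP] := (iffLR (compact_near_coveringP _)) Xcompact nat \oo P _.
  move=> x _; have [N xN] := loc x.
  exists ([set z | forall n, (N <= n)%N -> P n z], [set n | (N <= n)%N]) => /=.
    by split=> //; exact: nbhs_infty_ge.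
  by move=> [z n] /= [Pz Nn]; exact: Pz.
by exists N => n Nn z; exact: NP.
Qed.

Lemma gr_bounded a : exists M, forall x, gr a x < M.
Proof.
have [|N hN] := @uniformly_eventually (fun n x => gr a x < n%:R).
  move=> x; have [N aN] : exists N, gr a x + 1 <= N%:R.
    exists (Num.bound `|gr a x + 1|).
    exact: le_trans (ler_norm _) (ltW (archi_boundP (normr_ge0 _))).
  exists N; have : gr a x < gr a x + 1 by lra.
  move/near_gr_lt; apply: filterS => z az n Nn.
  by rewrite (lt_le_trans az)// (le_trans aN)// ler_nat.
by exists N%:R => x; exact: hN.
Qed.

Definition peak x (p : nat -> A) :=
  [/\ forall n, nonneg (p n), forall n, gr (p n) x = 1,
      forall n z, gr (p n) z <= 1,
      forall m n z, (m <= n)%N -> gr (p n) z <= gr (p m) z &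
      forall z, z <> x -> exists n, gr (p n) z = 0].

(** The product of Urysohn functions, each equal to 1 at [x] and killing one
    other point of the countable space. *)
Lemma peak_exists x : exists p, peak x p.
Proof.
have [e einj] := (countable_injP _ Xcountable).
have /choice[u uP] n : exists u, [/\ gr u x = 1, nonneg u, forall z, gr u z <= 1 &
    forall z, z <> x -> e z = n -> gr u z = 0].
  have [[z [zx zn]]|nz] := pselect (exists z, z <> x /\ e z = n); last first.
    exists 1; split=> [|||z zx zn]; rewrite ?gr1//; first exact: nonneg1.
      by move=> z; rewrite gr1.
    by case: nz; exists z.
  have [u [ux uz u01]] := urysohn_point (nesym zx).
  have u0 : nonneg u by move=> y; have /andP[] := u01 y.
  exists u; split=> // [|y|y yx yn]; rewrite ?/gr ?ux//.
    by rewrite -lecR -/(gr u y) -nonnegE//; have /andP[] := u01 y.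
  have -> : y = z by apply: einj; rewrite ?inE// yn zn.
  by rewrite uz.
pose p n := iteri n (fun i a => a * u i) 1.
have pS n : p n.+1 = p n * u n by [].
have p0 n : nonneg (p n).
  elim: n => [|n IH]; first exact: nonneg1.
  by rewrite pS; apply: nonnegM => //; have [] := uP n.
have pSg n z : gr (p n.+1) z = gr (p n) z * gr (u n) z.
  by rewrite pS grM//; have [] := uP n.
have pSle n z : gr (p n.+1) z <= gr (p n) z.
  rewrite pSg -[leRHS]mulr1 ler_wpM2l ?gr_ge0//.
  by have [_ _ + _] := uP n; apply.
have pmono m n z : (m <= n)%N -> gr (p n) z <= gr (p m) z.
  move=> mn; rewrite -(subnK mn); elim: (n - m)%N => [|j IH]; first exact: lexx.
  by rewrite addSn (le_trans (pSle _ _)).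
exists p; split=> // [n|n z|z zx].
- elim: n => [|n IH]; first exact: gr1.
  by rewrite pSg IH mul1r; have [] := uP n.
- by rewrite (le_trans (pmono 0%N n z _))// gr1.
- exists (e z).+1; rewrite pSg; have [_ _ _ ->//] := uP (e z).
  by rewrite mulr0.
Qed.

(** Dini: [h * p n] decreases to 0 pointwise, hence uniformly. *)
Lemma peak_dini x p h e : peak x p -> nonneg h -> gr h x = 0 -> 0 < e ->
  exists N, forall n, (N <= n)%N -> forall z, gr (h * p n) z < e.
Proof.
move=> [p0 px p1 pmono pz] h0 hx e0; apply: uniformly_eventually => z.
have [->|/pz[N pN]] := pselect (z = x).
  exists 0%N; have : gr h x < e by rewrite hx.
  move/near_gr_lt; apply: filterS => y hy n _.
  by rewrite grM// (le_lt_trans _ hy)// -[leRHS]mulr1 ler_wpM2l ?gr_ge0.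
exists N; have : gr (h * p N) z < e by rewrite grM// pN mulr0.
move/near_gr_lt; apply: filterS => y hy n Nn.
by rewrite (le_lt_trans _ hy)// !grM// ler_wpM2l ?gr_ge0// pmono.
Qed.

(** * Atoms of a unital completely positive map *)

Context {H : hilbertType R}.
Variables (phi : A -> 'B(H)) (phiU : ucp phi).
Let phiL : linear phi. Proof. by case: phiU. Qed.
Let phi1 : phi 1 = 1. Proof. by case: phiU. Qed.
Let phicp : completely_positive phi. Proof. by case: phiU. Qed.
Implicit Types (y : H) (E D : 'B(H)).

Lemma linZ c a : phi (c *: a) = c *: phi a.
Proof. by rewrite -[c *: a]addr0 phiL lin0// addr0. Qed.

Lemma nonneg_rip a y : nonneg a -> 0 <= rip (phi a y) y.
Proof. by move=> /nonneg_square[b _ <-]; exact: cp_rip_ge0. Qed.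

Lemma rip_le a b y : nonneg (b - a) -> rip (phi a y) y <= rip (phi b y) y.
Proof.
by move=> /nonneg_rip-/(_ y); rewrite linB// op_addE op_oppE ripDl ripNl subr_ge0.
Qed.

Lemma nonneg_selfadj a : nonneg a -> selfadj (phi a).
Proof.
by move=> a0; apply: selfadj_adjointP; rewrite (cp_star _ phiL phicp) nonneg_real.
Qed.

Lemma nsq_phi_le a b y : nonneg b ->
  (forall z, gr (star a * a) z <= gr b z) -> nsq (phi a y) <= rip (phi b y) y.
Proof.
move=> b0 ab; apply: le_trans (kadison_schwarz _ _ phiU) _.
by apply: rip_le; apply: nonneg_sub => //; exact: nonneg_star.
Qed.

Lemma gr_starM a b z : nonneg b ->
  gr (star (a * b) * (a * b)) z = gr (star a * a) z * gr b z * gr b z.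
Proof.
move=> b0; have -> : star (a * b) * (a * b) = star a * a * b * b.
  by rewrite star_mul nonneg_real// (mulrC b) mulrACA mulrA.
by do 2!rewrite grM//.
Qed.

(** Choose functions [f n] equal to 1 at the [n]-th point of [X], of mass at most
    [e / 2 ^ (n + 2)]. By compactness finitely many of them add up to at least
    [1 / 2] everywhere, so [|y| ^ 2 / 2] is at most [e / 2]. *)
Lemma null_vector y :
  (forall x e, 0 < e -> exists a, [/\ nonneg a, gr a x = 1 & rip (phi a y) y < e]) ->
  y = 0.
Proof.
move=> small; apply: nsq_eq0; apply/eqP; rewrite eq_le nsq_ge0 andbT.
apply/ler_addgt0Pr => e e0; rewrite add0r.
have [i iinj] := (countable_injP _ Xcountable).
have /choice[f fP] n : exists a, [/\ nonneg a, forall x, i x = n -> gr a x = 1 &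
    rip (phi a y) y <= e / 2 * 2^-1 ^+ n.+1].
  have en : 0 < e / 2 * 2^-1 ^+ n.+1.
    by rewrite mulr_gt0 ?divr_gt0 ?exprn_gt0 ?invr_gt0.
  have [[x xn]|nx] := pselect (exists x, i x = n); last first.
    exists 0; split=> [x|x xn|]; rewrite ?G0//; first by case: nx; exists x.
    by rewrite lin0// rip0l ltW.
  have [a [a0 ax ay]] := small x _ en; exists a; split=> // [z zn|]; last exact: ltW.
  by have -> : z = x by apply: iinj; rewrite ?inE// zn xn.
have f0 n : nonneg (f n) by have [] := fP n.
pose F n := \sum_(0 <= j < n) f j.
have FS n : F n.+1 = F n + f n by rewrite /F big_nat_recr.
have Fmono m n z : (m <= n)%N -> gr (F m) z <= gr (F n) z.
  move=> mn; rewrite -(subnK mn); elim: (n - m)%N => [|j IH]; first exact: lexx.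
  by rewrite addSn (le_trans IH)// FS grD lerDl gr_ge0.
have F0 n : nonneg (F n) by exact: nonneg_sum.
have [|N hN] := @uniformly_eventually (fun n z => 1 - gr (F n) z < 2^-1).
  move=> x; exists (i x).+1.
  have : gr (1 - F (i x).+1) x < 2^-1.
    rewrite grB gr1 FS grD; have [_ -> // _] := fP (i x).
    by have := gr_ge0 x (F0 (i x)); lra.
  move/near_gr_lt; apply: filterS => z; rewrite grB gr1 => hz n xn.
  by have := Fmono _ _ z xn; lra.
have Fy n : rip (phi (F n) y) y <= e / 2 * (1 - 2^-1 ^+ n).
  elim: n => [|n IH]; first by rewrite /F big_geq// lin0// rip0l expr0 subrr mulr0.
  rewrite FS linD// op_addE ripDl.
  have [_ _ fy] := fP n; rewrite (le_trans (lerD IH fy))//.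
  by rewrite -mulrDr ler_wpM2l ?divr_ge0 ?(ltW e0)// exprS; lra.
have : rip (phi ((2^-1)%:C *: (1 : A)) y) y <= rip (phi (F N) y) y.
  apply: rip_le; apply: nonneg_sub => // [|z].
    by apply: nonnegZ; [rewrite invr_ge0 | exact: nonneg1].
  have := hN N (leqnn N) z.
  rewrite [gr (_ *: _) _](_ : _ = 2^-1); first by lra.
  by rewrite /gr GZ G1 mulr1.
rewrite linZ phi1 op_scaleE ripZl op_oneE -/(nsq y).
have := Fy N; have : 0 <= (2^-1 : R) ^+ N by rewrite exprn_ge0// invr_ge0.
move: (2^-1 ^+ N) => r r0.
have : 0 <= e * r by rewrite mulr_ge0// ltW.
by lra.
Qed.

(** [E] is the mass that the operator valued measure of [phi] gives to the point
    [x], at which [p] peaks. *)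
Definition is_atom x p E :=
  forall a y, slim (fun n => phi (a * p n) y) (G a x *: E y).

(** The numbers [<phi(p n) y, y>] decrease, which makes [phi(p n) y] Cauchy since
    [T ^ 2 <= T] for [T] between 0 and 1. Multiplying by [a] only matters through
    [G a x], because [(a - G a x) * p n] tends to 0 uniformly. *)
Lemma atom_exists x p : peak x p -> exists E, is_atom x p E.
Proof.
move=> [p0 px p1 pmono pz].
have p01 n z : 0 <= gr (p n) z <= 1 by rewrite gr_ge0 ?p1.
have pb n y : nsq (phi (p n) y) <= 1 ^+ 2 * nsq y.
  have -> : 1 ^+ 2 * nsq y = rip (phi 1 y) y by rewrite phi1 expr1n mul1r.
  apply: nsq_phi_le => [|z]; first exact: nonneg1.
  have /andP[z0 z1] := p01 n z.
  by rewrite nonneg_real// grM// gr1 mulr_ile1.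
have [E slimE] : exists E : 'B(H), forall y, slim (fun n => phi (p n) y) (E y).
  apply: (op_slim pb) => y; apply: cauchy_slim => e e0.
  pose Q := range (fun n => rip (phi (p n) y) y).
  have Q0 : lbound Q 0 by move=> _ [n _ <-]; exact: nonneg_rip.
  have [|_ [N _ <-] QN] := @inf_adherent _ Q e e0.
    by split; [exists (rip (phi (p 0%N) y) y), 0%N | exists 0].
  exists N => n Nn.
  have Qn : inf Q <= rip (phi (p n) y) y.
    by apply: ge_inf; [exists 0 | exists n].
  rewrite -nsqN opprB -[_ - _]/((phi (p N) - phi (p n)) y) -linB//.
  have d0 : nonneg (p N - p n) by apply: nonneg_sub => // z; exact: pmono.
  apply: (@le_lt_trans _ _ (rip (phi (p N - p n) y) y)).
    apply: nsq_phi_le => // z; rewrite nonneg_real// grM// -[leRHS]mulr1.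
    rewrite ler_wpM2l ?gr_ge0// grB.
    by have /andP[] := p01 n z; have /andP[] := p01 N z; lra.
  by rewrite linB// op_addE op_oppE ripDl ripNl; lra.
exists E => a y; pose b : A := a - G a x *: (1 : A).
have bx : gr (star b * b) x = 0.
  by rewrite /gr GM Gstar /b GB GZ G1 mulr1 subrr mulr0.
have slim0 : slim (fun n => phi (b * p n) y) 0.
  apply/cvgr0Pnorm_lt => e e0; pose e' := e / (nsq y + 1).
  have y0 := nsq_ge0 y; have e'0 : 0 < e' by rewrite divr_gt0//; lra.
  have e'y : e' * nsq y < e by rewrite /e' mulrAC ltr_pdivrMr; nra.
  have [N hN] := peak_dini (And5 p0 px p1 pmono pz) (nonneg_star b) bx e'0.
  exists N => // n /= Nn; rewrite ger0_norm ?nsq_ge0// subr0.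
  apply: le_lt_trans e'y.
  have -> : e' * nsq y = rip (phi (e'%:C *: (1 : A)) y) y.
    by rewrite linZ phi1 op_scaleE ripZl.
  apply: nsq_phi_le => [|z].
    by apply: nonnegZ; [exact: ltW | exact: nonneg1].
  rewrite gr_starM// [leRHS](_ : _ = e'); last by rewrite /gr GZ G1 mulr1.
  have := hN n Nn z; rewrite grM// => /ltW; apply: le_trans.
  have /andP[z0 z1] := p01 n z.
  by rewrite -[leRHS]mulr1 ler_wpM2l// mulr_ge0// gr_ge0//; exact: nonneg_star.
have -> : (fun n => phi (a * p n) y) =
    (fun n => phi (b * p n) y + G a x *: phi (p n) y).
  apply/funext => n; rewrite -op_scaleE -linZ -op_addE -linD//; congr (phi _ y).
  apply: G_ext => z; rewrite GD GZ !GM /b GB GZ G1 mulr1.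
  by rewrite mulrBl subrK.
by rewrite -[_ *: E y]add0r; apply: slimD slim0 (slimZ _ (slimE y)).
Qed.

Lemma linear_ev x D : linear (fun a => G a x *: D).
Proof. by move=> k a b; rewrite GD GZ scalerDl scalerA. Qed.

Lemma linear_mulr b : linear (fun a => phi (a * b)).
Proof.
move=> k a a'; rewrite -linZ -linD//; congr phi; apply: G_ext => z.
by rewrite GD GZ !GM GD GZ mulrDl mulrA.
Qed.

Section Atom.
Variables (x : X) (p : nat -> A) (E : 'B(H)).
Hypotheses (pk : peak x p) (Eatom : is_atom x p E).

Lemma atom_slim y : slim (fun n => phi (p n) y) (E y).
Proof.
have := Eatom 1 y; rewrite G1 scale1r.
by rewrite (_ : (fun n => _) = fun n => phi (p n) y)//; apply/funext => n; rewrite mul1r.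
Qed.

Lemma atom_selfadj : selfadj E.
Proof.
have [p0 _ _ _ _] := pk.
move=> y z; have h1 := @slim_ripl _ _ _ _ z (atom_slim y).
have h2 := @slim_ripl _ _ _ _ y (atom_slim z).
apply: (@cvg_unique _ (@Rhausdorff R) (rip (phi (p n) y) z @[n --> \oo])) => //.
by rewrite (ripC y); apply: cvg_ext h2 => n; rewrite ripC -nonneg_selfadj.
Qed.

Lemma atom_pos : pos E.
Proof.
have [p0 _ _ _ _] := pk.
move=> y; apply: cvgr_to_ge (@slim_ripl _ _ _ _ y (atom_slim y)) _.
by apply: nearW => n; exact: nonneg_rip.
Qed.

Lemma atom_le1 y : rip (E y) y <= nsq y.
Proof.
have [p0 _ p1 _ _] := pk.
apply: cvgr_to_le (@slim_ripl _ _ _ _ y (atom_slim y)) _; apply: nearW => n.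
have -> : nsq y = rip (phi 1 y) y by rewrite phi1.
apply: rip_le; apply: nonneg_sub => // [|z]; first exact: nonneg1.
by rewrite gr1.
Qed.

Lemma cp_ev D : selfadj D -> pos D -> completely_positive (fun a => G a x *: D).
Proof.
move=> Ds Dp; apply/completely_positiveP; first exact: linear_ev.
move=> n c y; have := selfadj_inner_ge0 (\sum_i G (c i) x *: y i) Ds Dp.
congr (0 <= _); rewrite op_sum inner_sumr; apply: eq_bigr => i _.
rewrite inner_suml; apply: eq_bigr => j _.
by rewrite op_scaleE opZ innerZr !innerZl GM Gstar mulrA.
Qed.

Lemma cp_mulr b : nonneg b -> completely_positive (fun a => phi (a * b)).
Proof.
move=> /nonneg_square[r rr <-]; apply/completely_positiveP; first exact: linear_mulr.
have /completely_positiveP-/(_ phiL) cp := phicp.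
move=> n c y; have := cp n (fun i => c i * r) y; congr (0 <= _).
apply: eq_bigr => i _; apply: eq_bigr => j _; congr (inner (phi _ _) _).
by rewrite star_mul rr (mulrC r) mulrACA.
Qed.

(** Removing the atom is the limit of multiplying by [1 - p n]. *)
Lemma cp_sub_atom : completely_positive (fun a => phi a - G a x *: E).
Proof.
have [p0 _ p1 _ _] := pk.
apply: (@cp_slim _ _ _ (fun n a => phi (a * (1 - p n)))) => [n|n||a y].
- exact: linear_mulr.
- by apply: cp_mulr; apply: nonneg_sub => // [|z]; [exact: nonneg1 | rewrite gr1].
- by apply: linear_sub => //; exact: linear_ev.
- rewrite (_ : (fun n => _) = fun n => phi a y + (-1) *: phi (a * p n) y).
    rewrite op_addE op_oppE op_scaleE -(scaleN1r (G a x *: E y)).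
    exact: slimD (slim_cst _) (slimZ _ (Eatom a y)).
  by apply/funext => n; rewrite mulrBr mulr1 linB// op_addE op_oppE scaleN1r.
Qed.

(** Otherwise take [v], [l] and [w] from [rankone_perturbation]: halving [phi] and
    lowering its atom at [x] by [rankone v] gives a dominated map [psi], and
    [phi = S^* psi S] turns [w] into a null vector [S^-1 w] of
    [E - l (1 - E)]. *)
Lemma atom_idempotent : separable_space H -> cstar_extreme phi -> E * E = E.
Proof.
move=> sepH ext; apply: contrapT => nE.
have Es := atom_selfadj.
have [v [l [w [vE v1 w0 wl inj]]]] :=
  rankone_perturbation sepH Es atom_pos atom_le1 nE.
pose P := rankone v; have Ps : selfadj P := rankone_selfadj v.
have Pp : pos P by move=> y; rewrite rankone_rip addr_ge0// sqr_ge0.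
pose psi a := (2^-1)%:C *: ((phi a - G a x *: E) + G a x *: (E - P)).
have psiE a : psi a = (2^-1)%:C *: (phi a - G a x *: P).
  by rewrite /psi scalerBr addrA subrK.
have psi1 : psi 1 = (2^-1)%:C *: (1 + (-1)%:C *: P).
  by rewrite psiE phi1 G1 scale1r rmorphN1 scaleN1r.
have psi1' : 1 - psi 1 = (2^-1)%:C *: (1 + 1%:C *: P).
  rewrite psi1; apply: bounded_op_eqP => y; apply: rip_ext => z.
  by rewrite !opE !ripE; lra.
have psiL : linear psi.
  apply: linear_scale; apply: linear_add; last exact: linear_ev.
  by apply: linear_sub => //; exact: linear_ev.
have half0 : 0 <= (2^-1)%:C :> R[i] by rewrite ler0c invr_ge0.
have EPs : selfadj (E - P) by move=> y z; rewrite !opE !ripE Es Ps.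
have EPp : pos (E - P).
  by move=> y; rewrite !opE !ripE rankone_rip subr_ge0.
have [||||S [Si [SiS SSi]] phiS] := extreme_dominated ext psiL.
- by apply: cp_scale => //; apply: cp_add; [exact: cp_sub_atom | exact: cp_ev].
- rewrite (_ : (fun a => _) = fun a => (2^-1)%:C *: (phi a + G a x *: P)).
    by apply: cp_scale => //; apply: cp_add => //; exact: cp_ev.
  apply/funext => a; rewrite psiE; apply: bounded_op_eqP => y.
  by apply: rip_ext => z; rewrite !opE !ripE; lra.
- rewrite psi1; apply: invertible_scale; first by rewrite invr_eq0 pnatr_eq0.
  by apply: invertible_rankone; rewrite gt_eqF// mulN1r subr_gt0.
- rewrite psi1'; apply: invertible_scale; first by rewrite invr_eq0 pnatr_eq0.
  by apply: invertible_rankone; rewrite gt_eqF// mul1r ltr_pwDl// nsq_ge0.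
(* The relation [phi = S^* psi S] at [p n], in the limit. *)
have ES y : E y = adjoint S ((2^-1)%:C *: (E (S y) - P (S y))).
  apply: slim_unique (atom_slim y) _.
  have lim : slim (fun n => (2^-1)%:C *: (phi (p n) (S y) + - P (S y)))
    ((2^-1)%:C *: (E (S y) - P (S y))).
    exact: slimZ (slimD (atom_slim _) (slim_cst _)).
  rewrite (_ : (fun n => _) = adjoint S \o
    (fun n => (2^-1)%:C *: (phi (p n) (S y) + - P (S y)))); first exact: slim_op.
  apply/funext => n; have -> : phi (p n) y = adjoint S (psi (p n) (S y)) by rewrite phiS.
  by have [p0 px _ _ _] := pk; rewrite psiE (nonnegE _ (p0 n)) px scale1r.
have oneS y : y = adjoint S ((2^-1)%:C *: (S y - P (S y))).
  by rewrite -[LHS]/((1 : 'B(H)) y) -phi1 phiS !op_mulE psiE phi1 G1 scale1r.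
have SSiw : S (Si w) = w by exact: op_eqx w SSi.
have Siw : Si w = 0.
  apply: inj; rewrite [X in _ = _ *: X](_ : _ = adjoint S ((2^-1)%:C *: (w - E w))).
    by rewrite ES SSiw [X in adjoint S (_ *: X)]wl -opZ !scalerA mulrC.
  rewrite {1}(oneS (Si w)) ES SSiw -opB -scalerBr; congr (adjoint S (_ *: _)).
  by rewrite opprB addrA subrK.
by move: w0; rewrite -SSiw Siw op0 eqxx.
Qed.
End Atom.

(** An idempotent atom carries all the mass of [phi] on its range, where [phi]
    is therefore evaluation at [x]. *)
Lemma atom_eigen x p E : peak x p -> is_atom x p E -> E * E = E ->
  forall a y, phi a (E y) = G a x *: E y.
Proof.
move=> pk Eatom EE a y; have [p0 px p1 _ _] := pk.
pose u := E y; have Eu : E u = u by exact: op_eqx y EE.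
pose b : A := a - G a x *: (1 : A).
have bx : G b x = 0 by rewrite /b GB GZ G1 mulr1 subrr.
pose q n : A := 1 - p n.
have q0 n : nonneg (q n).
  by apply: nonneg_sub => // [|z]; [exact: nonneg1 | rewrite gr1].
have [M bM] := gr_bounded (star b * b).
have b0 := nonneg_star b.
have M0 : 0 <= M by rewrite (le_trans (gr_ge0 x b0))// ltW.
have qlim : slim (fun n => phi (b * q n) u) 0.
  apply: (@squeeze_cvgr _ _ _ _ (fun=> 0)
    (fun n => M * (nsq u - rip (phi (p n) u) u))).
  - apply: nearW => n; rewrite nsq_ge0/= subr0.
    have -> : M * (nsq u - rip (phi (p n) u) u) = rip (phi (M%:C *: q n) u) u.
      by rewrite linZ linB// phi1 op_scaleE ripZl op_addE op_oppE ripDl ripNl.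
    apply: nsq_phi_le => [|z]; first exact: nonnegZ.
    rewrite gr_starM// [leRHS](_ : _ = M * gr (q n) z); last first.
      by rewrite /gr GZ (nonnegE z (q0 n)) -rmorphM.
    rewrite ler_wpM2r ?gr_ge0//.
    have q1 : gr (q n) z <= 1 by rewrite grB gr1 gerBl gr_ge0.
    by rewrite (le_trans _ (ltW (bM z)))// -[leRHS]mulr1 ler_wpM2l ?gr_ge0.
  - exact: cvg_cst.
  - rewrite -[X in _ --> X](mulr0 M); apply: cvgMcst.
    have lim_u := @slim_ripl _ _ _ _ u (atom_slim Eatom u); rewrite Eu in lim_u.
    rewrite -(subrr (nsq u)).
    exact: (cvgB (@cvg_cst _ (nsq u) nat \oo _) lim_u).
have bu : phi b u = 0.
  apply: slim_unique (slim_cst _) _.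
  have := slimD (Eatom b u) qlim; rewrite bx scale0r addr0.
  congr (slim _ _); apply/funext => n.
  by rewrite -op_addE -linD// -mulrDr /q addrC subrK mulr1.
apply/subr0_eq; rewrite -{}[RHS]bu /b linB// linZ phi1.
by [].
Qed.

(** The defect [D] of multiplicativity satisfies [D E = 0] for every atom [E], so
    its adjoint takes values that all atoms annihilate. *)
Lemma extreme_homomorphism : separable_space H -> cstar_extreme phi ->
  star_homomorphism phi.
Proof.
move=> sepH ext; split=> // [a b|a]; last by rewrite cp_star.
apply/subr0_eq; set D := _ - _.
suff D0 : adjoint D = 0.
  rewrite -[LHS]adjointK D0.
  by apply: adjoint_unique => y z; rewrite !opE rip0l rip0r.
apply: bounded_op_eqP => y; rewrite op_zeroE; apply: null_vector => x e e0.
have [p pk] := peak_exists x; have [E Eatom] := atom_exists pk.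
have EE : E * E = E by exact: atom_idempotent pk Eatom sepH ext.
have phiE := atom_eigen pk Eatom EE.
have Es := atom_selfadj pk Eatom.
have DE (z : H) : D (E z) = 0.
  rewrite /D op_addE op_oppE op_mulE !phiE opZ phiE scalerA GM mulrC.
  by rewrite subrr.
have EDy : E (adjoint D y) = 0.
  by apply: rip_ext => z; rewrite Es -rip_adjr DE rip0l rip0r.
have : rip (phi (p n) (adjoint D y)) (adjoint D y) @[n --> \oo] --> (0 : R).
  have := @slim_ripl _ _ _ _ (adjoint D y) (atom_slim Eatom (adjoint D y)).
  by rewrite EDy rip0l.
move=> /cvgr_lt/(_ _ e0)[N _ /(_ N (leqnn N)) /= small].
by have [p0 px _ _ _] := pk; exists (p N).
Qed.
End Spectrum.

(** * The theorem *)

Theorem theorem7p7 (R : realType) (A : comCStarAlgType R) (X : topologicalType)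
    (H : hilbertType R) (phi : A -> 'B(H)) :
  is_spectrum A X -> countable [set: X] ->
  separable_space H -> ucp phi ->
  cstar_extreme phi <-> star_homomorphism phi.
Proof.
move=> [Xc Xh [G [[GL Gi Gr] G1 GM Gs]]] Xn sepH phiU; split.
  exact: (extreme_homomorphism Xc Xh Xn GL Gi Gr G1 GM Gs phiU sepH).
exact: homomorphism_extreme.
Qed.
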